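(* Let $\rho=\rho(\epsilon)$ be defined in the asymptotic range $\epsilon^2 \ll \rho \leq \epsilon$ and let ${\bf a}_0\in\ell^2(\mathbb{Z})$ be fixed independently of $\epsilon$. For every $\tau_0>0$, there is a small $\epsilon_0>0$ and positive constants $C_0$ and $C$ (independent of $\epsilon$) such that for every $\epsilon\in(0,\epsilon_0)$ for which the initial data satisfies $$\|\xi(0)-{\bf X}(0)\|_{\ell^2}+\|\dot{\xi}(0)-\dot{\bf X}(0)\|_{\ell^2}\leq C_0\,\rho^{-1}\epsilon^2,$$ the solution $\xi(t)$ of the discrete Klein--Gordon equation $$\ddot{\xi}_j+\xi_j+\rho\,\xi_j^3=\epsilon(\xi_{j+1}+\xi_{j-1}),\qquad j\in\mathbb{Z},$$ satisfies, for every $t\in[-\tau_0\rho^{-1},\tau_0\rho^{-1}]$, $$\|\xi(t)-{\bf X}(t)\|_{\ell^2}+\|\dot{\xi}(t)-\dot{\bf X}(t)\|_{\ell^2}\leq C\,\rho^{-1}\epsilon^2.$$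
   Context: Here $\xi(t)=\{\xi_j(t)\}_{j\in\mathbb{Z}}$ is real-valued with $\xi(t),\dot\xi(t)\in\ell^2(\mathbb{Z})$, and dots on $\xi$ and ${\bf X}$ denote $d/dt$. The notation $\epsilon^2\ll\rho\le\epsilon$ means that $\rho=\rho(\epsilon)>0$ satisfies $\rho\leq\epsilon$ and $\epsilon^2/\rho\to0$ as $\epsilon\to0^+$. Set $\nu=\rho/\epsilon$ and let ${\bf a}(\tau)=\{a_j(\tau)\}_{j\in\mathbb{Z}}$, $a_j(\tau)\in\mathbb{C}$, be the global solution in $\ell^2(\mathbb{Z})$ of the discrete nonlinear Schr\''odinger equation $$2i\dot a_j+3\nu|a_j|^2a_j=a_{j+1}+a_{j-1},\qquad j\in\mathbb{Z},$$ with ${\bf a}(0)={\bf a}_0$, where the dot on $a_j$ is the derivative in the slow time $\tau=\epsilon t$. The leading-order approximation ${\bf X}(t)=\{X_j(t)\}_{j\in\mathbb{Z}}$ is $$X_j(t)=a_j(\epsilon t)e^{it}+\bar a_j(\epsilon t)e^{-it}+\tfrac18\rho\left(a_j^3(\epsilon t)e^{3it}+\bar a_j^3(\epsilon t)e^{-3it}\right).$$ *)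

(* Defs.v *)
From mathcomp Require Export all_boot all_order all_algebra.
From mathcomp Require Export complex.
From mathcomp Require Export all_classical all_reals all_analysis.

Set Implicit Arguments.
Unset Strict Implicit.
Unset Printing Implicit Defensive.

Export Order.TTheory GRing.Theory Num.Theory.
Export numFieldNormedType.Exports.

Local Open Scope classical_set_scope.
Local Open Scope ring_scope.

(* The value is +oo when u is not square summable; u lies in ell^2(Z) iff
   l2norm u < +oo. *)
Definition l2norm (R : realType) (V : normedZmodType R) (u : int -> V) : \bar R :=
  sqrte (\esum_(j in [set: int]) (`|u j| ^+ 2)%:E).

(* Rcomplex R is R[i] with the modulus taken in R. *)
Definition l2normC (R : realType) (u : int -> R[i]) : \bar R :=
  @l2norm R (Rcomplex R) u.

(* y is the derivative at t, in the norm of ell^2(Z), of the restriction of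
   the curve x to I (one-sided at an endpoint of I). *)
Definition is_l2_derive (R : realType) (I : set R) (x : R -> int -> R)
    (t : R) (y : int -> R) : Prop :=
  l2norm (fun j => (x s j - x t j) / (s - t) - y j)
    @[s --> within I (dnbhs t)] --> 0%E.

Definition is_l2_deriveC (R : realType) (I : set R) (x : R -> int -> R[i])
    (t : R) (y : int -> R[i]) : Prop :=
  is_l2_derive I (fun s j => complex.Re (x s j)) t (fun j => complex.Re (y j)) /\
  is_l2_derive I (fun s j => complex.Im (x s j)) t (fun j => complex.Im (y j)).

(* a is a global solution in ell^2(Z) of
   2 i a_j' + 3 nu |a_j|^2 a_j = a_{j+1} + a_{j-1}; b is a'(tau). *)
Definition dNLS_solution (R : realType) (nu : R) (a : R -> int -> R[i]) : Prop :=
  forall tau : R,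
    (l2normC (a tau) < +oo)%E /\
    exists b : int -> R[i],
      is_l2_deriveC [set: R] a tau b /\
      forall j : int,
        2 * 'i * b j + 3 * nu%:C%C * `|a tau j| ^+ 2 * a tau j
        = a tau (j + 1) + a tau (j - 1).

(* xi is a solution in ell^2(Z), on the time interval I, of
   xi_j'' + xi_j + rho xi_j^3 = eps (xi_{j+1} + xi_{j-1});
   eta is xi' and zeta is xi''(t). *)
Definition dKG_solution (R : realType) (rho eps : R) (I : set R)
    (xi eta : R -> int -> R) : Prop :=
  forall t : R, I t ->
    [/\ (l2norm (xi t) < +oo)%E,
        (l2norm (eta t) < +oo)%E,
        is_l2_derive I xi t (eta t) &
        exists zeta : int -> R,
          is_l2_derive I eta t zeta /\
          forall j : int,
            zeta j + xi t j + rho * xi t j ^+ 3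
            = eps * (xi t (j + 1) + xi t (j - 1))].

Definition expi (R : realType) (theta : R) : R[i] := (cos theta +i* sin theta)%C.

(* The complex number below equals its own conjugate; Re only moves it to R. *)
Definition leading_order (R : realType) (rho eps : R) (a : R -> int -> R[i])
    (t : R) (j : int) : R :=
  complex.Re (a (eps * t) j * expi t + (a (eps * t) j)^* * expi (- t)
    + 8^-1 * rho%:C%C * (a (eps * t) j ^+ 3 * expi (3 * t)
                         + (a (eps * t) j)^* ^+ 3 * expi (- (3 * t)))).

Definition leading_order_dot (R : realType) (rho eps : R) (a : R -> int -> R[i])
    (t : R) (j : int) : R :=
  derive1 (fun s => leading_order rho eps a s j) t.

(* Main.v *)
Require Import Defs.
From mathcomp Require Import ring lra zify.

(* Substituting X into the Klein-Gordon equation, the e^{it} terms of order eps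
   and rho cancel by the dNLS equation and the e^{3it} terms of order rho cancel
   by the choice of the coefficient 1/8; since the ell^2 norm of a is conserved,
   the residual is O(eps^2) in ell^2, uniformly in time.  The error
   y = xi - X solves
     y'' + y - eps (y_+ + y_-) + rho (xi^2 + xi X + X^2) y + Res = 0,
   whose energy (|y'|^2 + |y|^2)/2 - eps <y, y_+> grows at rate O(rho) with
   forcing O(eps^4 / rho), so Gronwall's inequality over times tau0 / rho gives
   |y| + |y'| = O(eps^2 / rho).  The coefficient xi^2 + xi X + X^2 is bounded
   because the quartic term of the Klein-Gordon energy is nonnegative, which
   bounds xi a priori and makes a continuation argument unnecessary.
   To differentiate only finite sums, all energies carry the cutoff
   max(0, 1 - |j|/N); its slope 1/N makes the flux between neighbouring sites
   O(1/N), and N tends to infinity after Gronwall. *)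

Local Open Scope classical_set_scope.
Local Open Scope ring_scope.

(** * Square summability through finite partial sums *)

(** [B] bounds the square of the norm, not the norm. Testing duplicate-free finite lists keeps every
    estimate in the reals, with no convergence of series to discuss. *)
Definition l2le {R : realType} (u : int -> R) (B : R) : Prop :=
  forall r : seq int, uniq r -> \sum_(j <- r) u j ^+ 2 <= B.

Lemma l2le_ge0 {R : realType} (u : int -> R) (B : R) : l2le u B -> 0 <= B.
Proof. by move=> /(_ [::] isT); rewrite big_nil. Qed.

Lemma l2le_sqr {R : realType} (u : int -> R) (B : R) (j : int) :
  l2le u B -> u j ^+ 2 <= B.
Proof. by move=> /(_ [:: j] isT); rewrite big_seq1. Qed.

Lemma l2le_le {R : realType} (u v : int -> R) (B : R) :
  (forall j, `|u j| <= `|v j|) -> l2le v B -> l2le u B.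
Proof.
move=> uv vB r /vB; apply: le_trans; apply: ler_sum => j _.
by rewrite -(real_normK (num_real (u j))) -(real_normK (num_real (v j)))
  lerXn2r// nnegrE.
Qed.

Lemma l2le_leB {R : realType} (u : int -> R) (B B' : R) :
  B <= B' -> l2le u B -> l2le u B'.
Proof. by move=> BB' uB r /uB /le_trans; apply. Qed.

Lemma l2leZ {R : realType} (c : R) (u : int -> R) (B : R) :
  l2le u B -> l2le (fun j => c * u j) (c ^+ 2 * B).
Proof.
move=> uB r /uB rB; under eq_bigr do rewrite exprMn.
by rewrite -big_distrr /= ler_wpM2l ?sqr_ge0.
Qed.

Lemma l2leN {R : realType} (u : int -> R) (B : R) :
  l2le u B -> l2le (fun j => - u j) B.
Proof. by apply: l2le_le => j; rewrite normrN. Qed.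

Lemma l2le_shift {R : realType} (m : int) (u : int -> R) (B : R) :
  l2le u B -> l2le (fun j => u (j + m)) B.
Proof.
move=> uB r ur; rewrite -(big_map (fun j => j + m) xpredT (fun j => u j ^+ 2)).
by apply: uB; rewrite map_inj_uniq//; exact: addIr.
Qed.

Lemma l2leD {R : realType} (u v : int -> R) (A B : R) :
  l2le u A -> l2le v B -> l2le (fun j => u j + v j) (2 * (A + B)).
Proof.
move=> uA vB r ur.
have h : \sum_(j <- r) (u j + v j) ^+ 2 <=
    2 * (\sum_(j <- r) u j ^+ 2 + \sum_(j <- r) v j ^+ 2).
  rewrite -big_split /= big_distrr /=; apply: ler_sum => j _.
  by have := sqr_ge0 (u j - v j); nra.
by apply: (le_trans h); rewrite ler_wpM2l// lerD ?uA ?vB.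
Qed.

(** The extended sum is a supremum over finite sets, and finite sets correspond to duplicate-free
    lists. *)
Lemma l2le_esum {R : realType} (u : int -> R) (B : R) :
  l2le u B <-> (\esum_(j in [set: int]) (`|u j| ^+ 2)%:E <= B%:E)%E.
Proof.
have nE j : `|u j| ^+ 2 = u j ^+ 2 by rewrite real_normK// num_real.
split=> [uB|uB r ur].
  apply: ge_ereal_sup => _ [F [finF _] <-].
  rewrite fsbig_finite//= sumEFin lee_fin; under eq_bigr do rewrite nE.
  exact/uB/finmap.fset_uniq.
rewrite -lee_fin; apply: le_trans uB; apply: esum_ge; exists [set` r].
  by split=> //; exact: finite_seq.
rewrite -fsbig_seq//= sumEFin lee_fin; apply: ler_sum => j _; by rewrite nE.
Qed.

Lemma l2norm_le {R : realType} (u : int -> R) (c : R) : 0 <= c ->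
  (l2norm u <= c%:E)%E <-> l2le u (c ^+ 2).
Proof.
move=> c0; rewrite l2le_esum /l2norm.
have -> : c%:E = sqrte ((c ^+ 2)%:E) by rewrite /= sqrtr_sqr ger0_norm.
by rewrite lee_sqrt// lee_fin sqr_ge0.
Qed.

Lemma l2norm_fin {R : realType} (u : int -> R) :
  (l2norm u < +oo)%E -> exists B, l2le u B.
Proof.
have : (0 <= l2norm u)%E by exact: sqrte_ge0.
case E : (l2norm u) => [c| |]// c0 _; exists (c ^+ 2).
by apply/l2norm_le; rewrite ?E// -lee_fin.
Qed.

(** The squared modulus unfolds to the sum of the squares of the two parts, so each part is
    dominated term by term. *)
Lemma l2normC_fin {R : realType} (u : int -> R[i]) :
  (l2normC u < +oo)%E -> exists2 A, l2le (fun j => complex.Re (u j)) A &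
    l2le (fun j => complex.Im (u j)) A.
Proof.
have : (0 <= l2normC u)%E by exact: sqrte_ge0.
case E : (l2normC u) => [c| |]//; rewrite lee_fin => c0 _; exists (c ^+ 2);
  apply/l2norm_le => //; rewrite -E lee_sqrt ?esum_ge0//;
  apply: le_esum => j _; rewrite lee_fin; case: (u j) => x y;
  have -> : `|(x +i* y)%C : Rcomplex R| = Num.sqrt (x ^+ 2 + y ^+ 2) by [];
  rewrite sqr_sqrtr ?addr_ge0 ?sqr_ge0// real_normK ?num_real//=.
- by rewrite lerDl sqr_ge0.
- by rewrite lerDr sqr_ge0.
Qed.

(** * Derivatives and continuity of explicit real expressions *)

Section calculus.
Context {R : realType}.
Implicit Types (f g : R -> R) (x a b c : R).

(** The rules are restated for functions written [fun s => ...], so that the derivative of a long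
    expression is a nested term and only an identity between values remains for [ring] or
    [field]. *)
Lemma dD {f g x a b} : is_derive x 1 f a -> is_derive x 1 g b ->
  is_derive x 1 (fun s => f s + g s) (a + b).
Proof. exact: is_deriveD. Qed.

Lemma dB {f g x a b} : is_derive x 1 f a -> is_derive x 1 g b ->
  is_derive x 1 (fun s => f s - g s) (a - b).
Proof. exact: is_deriveB. Qed.

Lemma dN {f x a} : is_derive x 1 f a -> is_derive x 1 (fun s => - f s) (- a).
Proof. exact: is_deriveN. Qed.

Lemma dM {f g x a b} : is_derive x 1 f a -> is_derive x 1 g b ->
  is_derive x 1 (fun s => f s * g s) (f x * b + g x * a).
Proof. exact: is_deriveM. Qed.

Lemma dX {f} n {x a} : is_derive x 1 f a ->
  is_derive x 1 (fun s => f s ^+ n) (n%:R * f x ^+ n.-1 * a).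
Proof.
have -> : (fun s => f s ^+ n) = f ^+ n; last exact: is_deriveX.
by apply/funext => s; elim: n => // n IH; rewrite !exprS IH.
Qed.

Lemma dC c x : is_derive x 1 (fun=> c) 0.
Proof. exact: is_derive_cst. Qed.

Lemma d_comp {f g x a b} : is_derive x 1 g b -> is_derive (g x) 1 f a ->
  is_derive x 1 (fun s => f (g s)) (a * b).
Proof. by move=> dg df; have := @is_derive1_comp _ f g x a b df dg. Qed.

Lemma dcl c x : is_derive x 1 (fun s => c * s) c.
Proof.
apply: is_derive_eq (dM (dC c x) (is_derive_id x 1)) _.
by rewrite mulr1 mulr0 addr0.
Qed.

Lemma dlin {c f x a} : is_derive (c * x) 1 f a ->
  is_derive x 1 (fun s => f (c * s)) (a * c).
Proof.
by move=> df; apply: d_comp df; exact: dcl.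
Qed.

Lemma dcoslin c x : is_derive x 1 (fun s => cos (c * s)) (- sin (c * x) * c).
Proof. exact: dlin. Qed.

Lemma dsinlin c x : is_derive x 1 (fun s => sin (c * s)) (cos (c * x) * c).
Proof. exact: dlin. Qed.

Lemma dexpRlin c x :
  is_derive x 1 (fun s => expR (c * s)) (expR (c * x) * c).
Proof. exact: dlin. Qed.

Lemma dsum {I : Type} (r : seq I) {F : I -> R -> R} {dF : I -> R} {x} :
  (forall i, is_derive x 1 (F i) (dF i)) ->
  is_derive x 1 (fun s => \sum_(i <- r) F i s) (\sum_(i <- r) dF i).
Proof.
move=> h; elim: r => [|i r IH].
  under eq_fun do rewrite big_nil.
  by rewrite big_nil; exact: dC.
under eq_fun do rewrite big_cons.
by rewrite big_cons; exact: dD.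
Qed.

Context {I : set R}.

(** Continuity relative to [I] is what survives at the endpoints of a closed time interval, where
    only one-sided limits are available. *)
Lemma cwD {f g} : {within I, continuous f} -> {within I, continuous g} ->
  {within I, continuous (fun s => f s + g s)}.
Proof. by move=> cf cg x; apply: cvgD; [exact: cf|exact: cg]. Qed.

Lemma cwN {f} : {within I, continuous f} ->
  {within I, continuous (fun s => - f s)}.
Proof. by move=> cf x; apply: cvgN; exact: cf. Qed.

Lemma cwM {f g} : {within I, continuous f} -> {within I, continuous g} ->
  {within I, continuous (fun s => f s * g s)}.
Proof. by move=> cf cg x; apply: cvgM; [exact: cf|exact: cg]. Qed.

Lemma cwC c : {within I, continuous (fun=> c : R)}.
Proof. by move=> x; exact: cvg_cst. Qed.

Lemma cwX {f} n : {within I, continuous f} ->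
  {within I, continuous (fun s => f s ^+ n)}.
Proof.
move=> cf; elim: n => [|n IH]; first exact: cwC.
by under eq_fun do rewrite exprS; exact: cwM.
Qed.

Lemma cwsum {T : Type} (r : seq T) {F : T -> R -> R} :
  (forall i, {within I, continuous (F i)}) ->
  {within I, continuous (fun s => \sum_(i <- r) F i s)}.
Proof.
move=> h; elim: r => [|i r IH].
  by under eq_fun do rewrite big_nil; exact: cwC.
by under eq_fun do rewrite big_cons; exact: cwD.
Qed.

Lemma cw_derive {f} {df : R -> R} : (forall x, is_derive x 1 f (df x)) ->
  {within I, continuous f}.
Proof.
move=> h; apply: continuous_subspaceT => x.
apply/differentiable_continuous/derivable1_diffP.
by have := h x => -[].
Qed.

End calculus.

(** * Gronwall inequalities *)

(** The function f e^{-kappa t} - D t is nonincreasing, since e^{-kappa t} <= 1. Nothing is divided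
    by [kappa], so the case [kappa = 0] is covered and serves for conserved quantities. *)
Lemma gronwall_pos {R : realType} (T kappa D : R) (f df : R -> R) :
  0 <= kappa -> 0 <= D -> {within `[0, T], continuous f} ->
  (forall t : R, t \in `]0, T[ -> is_derive t 1 f (df t)) ->
  (forall t : R, t \in `]0, T[ -> df t <= kappa * f t + D) ->
  forall t : R, t \in `[0, T] -> f t <= (f 0 + D * t) * expR (kappa * t).
Proof.
move=> k0 D0 cf hdf hle t; rewrite in_itv/= => /andP[t0 tT].
pose g s := f s * expR (- kappa * s) - D * s.
have dg (s : R) : s \in `]0, T[ ->
    is_derive s 1 g (expR (- kappa * s) * (df s - kappa * f s) - D).
  move=> sT.
  apply: is_derive_eq (dB (dM (hdf s sT) (dexpRlin (- kappa) s)) (dcl D s)) _.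
  by ring.
have cg : {within `[0, T], continuous g}.
  apply: cwD; last apply: cwN.
    apply: cwM => //; apply: cw_derive => s; exact: dexpRlin.
  apply: cw_derive => s; exact: dcl.
have : g t <= g 0.
  apply: (@ler0_derive1_le_cc _ g 0 T) => //.
  - by move=> s sT; have [] := dg s sT.
  - move=> s sT; rewrite derive1E; have [_ ->] := dg s sT.
    have := hle s sT; have : expR (- kappa * s) <= 1.
      rewrite -expR0 ler_expR mulNr oppr_le0 mulr_ge0//.
      by move: sT; rewrite in_itv/= => /andP[/ltW].
    have := expR_ge0 (- kappa * s); nra.
  - by rewrite in_itv/= t0.
  - by rewrite in_itv/= lexx (le_trans t0).
rewrite /g !mulr0 expR0 mulr1 subr0 mulNr expRN lerBlDr => h.
by rewrite -ler_pdivrMr ?expR_gt0.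
Qed.

(** Negative times reduce to positive ones for f(-s); the bound on the absolute value of the
    derivative is invariant under this reflection. *)
Lemma gronwall {R : realType} (T kappa D : R) (f df : R -> R) :
  0 <= kappa -> 0 <= D -> {within `[- T, T], continuous f} ->
  (forall t : R, t \in `]- T, T[ -> is_derive t 1 f (df t)) ->
  (forall t : R, t \in `]- T, T[ -> `|df t| <= kappa * f t + D) ->
  forall t : R, t \in `[- T, T] -> f t <= (f 0 + D * `|t|) * expR (kappa * `|t|).
Proof.
move=> k0 D0 cf hdf hle t tT.
have T0 : 0 <= T by move: tT; rewrite in_itv/=; lra.
have [t0|t0] := leP 0 t.
  rewrite (ger0_norm t0).
  have h := @gronwall_pos R T kappa D f df k0 D0; apply h.
  - apply: continuous_subspaceW cf; apply: subset_itvr; rewrite bnd_simp; lra.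
  - by move=> s; rewrite in_itv/= => sT; apply: hdf; rewrite in_itv/=; lra.
  - move=> s; rewrite in_itv/= => sT; apply: le_trans (ler_norm _) _.
    by apply: hle; rewrite in_itv/=; lra.
  - by move: tT; rewrite !in_itv/=; lra.
rewrite (ltr0_norm t0).
have tN : - t \in `[0, T] by move: tT; rewrite !in_itv/=; lra.
have := @gronwall_pos _ T kappa D (fun s => f (- s)) (fun s => - df (- s)) k0 D0.
rewrite oppr0 => h; rewrite -[t in f t]opprK; apply h.
- apply: within_continuous_compN; apply: continuous_subspaceW cf.
  by apply: subset_itvl; rewrite bnd_simp; lra.
- move=> s; rewrite in_itv/= => sT; rewrite -mulrN1.
  apply: (@d_comp _ f -%R).
  by apply: hdf; rewrite in_itv/=; lra.
- move=> s; rewrite in_itv/= => sT; apply: le_trans (ler_norm _) _.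
  by rewrite normrN; apply: hle; rewrite in_itv/=; lra.
- exact: tN.
Qed.

(** * The cutoff and summation by parts on the lattice *)

(** The sites from -N to N - 1. With this half-open range, telescoping sums end exactly at -N and N,
    where the cutoff vanishes. *)
Definition win (N : nat) : seq int := [seq k%:Z - N%:Z | k <- iota 0 (2 * N)].

Lemma win_uniq N : uniq (win N).
Proof.
rewrite map_inj_uniq ?iota_uniq// => i j h.
by have [] : i%:Z = j%:Z by exact: (addIr _ h).
Qed.

Lemma mem_win N (j : int) : (`|j| < N)%N -> j \in win N.
Proof.
move=> jN; apply/mapP; exists (absz (j + N%:Z)%R); last by lia.
by rewrite mem_iota; lia.
Qed.

Section cutoff.
Context {R : realType}.

(** Truncated subtraction of naturals supplies the maximum with zero in max(0, 1 - |j|/N). For N = 0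
    the value is 0, the inverse of zero being zero. *)
Definition cut (N : nat) (j : int) : R := (N - `|j|)%N%:R / N%:R.

Lemma cut_ge0 N j : 0 <= cut N j.
Proof. by rewrite /cut divr_ge0. Qed.

Lemma cut_le1 N j : cut N j <= 1.
Proof.
rewrite /cut; case: N => [|N]; first by rewrite invr0 mulr0.
by rewrite ler_pdivrMr ?ltr0n// mul1r ler_nat; lia.
Qed.

(** |j| and |j + 1| differ by one, and truncation at zero does not widen the gap, so the numerators
    differ by at most one. *)
Lemma cut_lip N j : `|cut N j - cut N (j + 1)| <= N%:R^-1.
Proof.
rewrite /cut -mulrBl normrM [X in _ * X]ger0_norm ?invr_ge0//.
rewrite ler_piMl ?invr_ge0//.
have [h|h] : ((N - `|j|)%N = (N - absz (j + 1)%R)%N \/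
   (N - `|j|)%N = (N - absz (j + 1)%R).+1%N) \/
   (N - `|j|).+1%N = (N - absz (j + 1)%R)%N by lia.
  by case: h => ->; rewrite ?subrr ?normr0// -addn1 natrD addrAC subrr add0r normr1.
by rewrite -h -addn1 natrD opprD addrA subrr add0r normrN normr1.
Qed.

Lemma cut_end N : cut N (- N%:Z) = 0 /\ cut N N%:Z = 0.
Proof. by split; rewrite /cut ?abszN absz_nat subnn mul0r. Qed.

Lemma win_tele N (F : int -> R) :
  \sum_(j <- win N) (F (j + 1) - F j) = F N%:Z - F (- N%:Z).
Proof.
rewrite /win big_map.
have -> : F N%:Z = F ((2 * N)%N%:Z - N%:Z) by congr F; lia.
have -> : F (- N%:Z) = F (0%N%:Z - N%:Z) by congr F; lia.
rewrite -(telescope_sumr (fun k : nat => F (k%:Z - N%:Z)) (leq0n (2 * N))).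
rewrite /index_iota subn0; apply: eq_bigr => k _.
by congr (F _ - _); lia.
Qed.

(** Adding this null sum performs a summation by parts without boundary terms. *)
Lemma win_cut_tele N (K : int -> R) :
  \sum_(j <- win N) (cut N (j + 1) * K (j + 1) - cut N j * K j) = 0.
Proof.
rewrite (win_tele N (fun j => cut N j * K j)).
by have [-> ->] := cut_end N; rewrite !mul0r subrr.
Qed.

(** At each fixed site the cutoff tends to 1. If some partial sum s exceeded B, with all its sites
    in |j| <= m, then (N - m) s <= N B + D would fail for large N. *)
Lemma l2le_cut (u : int -> R) (B D : R) :
  (forall N, (0 < N)%N ->
    \sum_(j <- win N) cut N j * u j ^+ 2 <= B + D / N%:R) ->
  l2le u B.
Proof.
move=> h r ur; rewrite leNgt; apply/negP => Bs.
set s := \sum_(j <- r) u j ^+ 2 in Bs.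
(* A crude bound on the sites of [r]: the sum of the |j| dominates each of them. *)
pose m := (\sum_(j <- r) `|j|)%N.
have jm j : j \in r -> (`|j| <= m)%N.
  by move=> jr; rewrite /m (bigD1_seq j)//= leq_addr.
have key N : (m < N)%N -> (N%:R - m%:R) * s <= N%:R * B + D.
  move=> mN; have N0 : (0 < N)%N by lia.
  have N0' : 0 < N%:R :> R by rewrite ltr0n.
  have := h N N0; rewrite -(ler_pM2l N0') mulrDr [N%:R * (D / _)]mulrCA.
  rewrite divff ?mulr1 ?gt_eqF//; apply: le_trans.
  have : \sum_(j <- r) cut N j * u j ^+ 2 <=
         \sum_(j <- win N) cut N j * u j ^+ 2.
    rewrite [leRHS](bigID (fun j => j \in r))/= -[leLHS]addr0; apply: lerD.
      rewrite -[leRHS]big_filter le_eqVlt; apply/orP; left; apply/eqP/perm_big.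
      apply: uniq_perm => //; first by rewrite filter_uniq// win_uniq.
      move=> j; rewrite mem_filter; case jr : (j \in r) => //=.
      by rewrite mem_win//; have := jm j jr; lia.
    by apply: sumr_ge0 => j _; rewrite mulr_ge0 ?cut_ge0 ?sqr_ge0.
  move=> W; apply: le_trans (ler_wpM2l (ltW N0') W).
  rewrite /s !mulr_sumr big_seq [leRHS]big_seq; apply: ler_sum => j /jm jr.
  rewrite [leRHS]mulrA ler_wpM2r ?sqr_ge0// /cut mulrCA divff ?mulr1 ?gt_eqF//.
  by rewrite -natrB ?ler_nat; lia.
have [n nP] : exists n, (m%:R * s + D) / (s - B) < n%:R.
  exists (Num.truncn ((m%:R * s + D) / (s - B))).+1; exact: truncnS_gt.
have := key (n + m).+1 ltac:(lia).
move: nP; rewrite ltr_pdivrMr ?subr_gt0// => nP.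
rewrite -addn1 !natrD => k.
have m0 : 0 <= m%:R :> R by [].
have : 0 <= m%:R * (s - B) by rewrite mulr_ge0// subr_ge0 ltW.
lra.
Qed.

(** With K_j = x_j z_{j+1} - z_j x_{j+1}, the summand is the cutoff times K_j - K_{j-1}. Summation
    by parts moves the difference onto the cutoff, whose slope is at most 1/N. *)
Lemma cut_flux N (x z : int -> R) (A B : R) : l2le x A -> l2le z B ->
  `|\sum_(j <- win N) cut N j *
      (x j * (z (j + 1) + z (j - 1)) - z j * (x (j + 1) + x (j - 1)))|
  <= (A + B) / N%:R.
Proof.
move=> xA zB; pose K j := x j * z (j + 1) - z j * x (j + 1).
have -> : \sum_(j <- win N) cut N j *
      (x j * (z (j + 1) + z (j - 1)) - z j * (x (j + 1) + x (j - 1))) =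
    \sum_(j <- win N) (cut N j - cut N (j + 1)) * K j.
  rewrite -[RHS]addr0 -[X in _ = _ + X](win_cut_tele N (fun j => K (j - 1))) -big_split/=.
  apply: eq_bigr => j _; rewrite /K !addrK; ring.
apply: le_trans (ler_norm_sum _ _ _) _.
have h j : `|(cut N j - cut N (j + 1)) * K j| <=
    N%:R^-1 * (2^-1 * (x j ^+ 2 + x (j + 1) ^+ 2 + (z j ^+ 2 + z (j + 1) ^+ 2))).
  rewrite normrM ler_pM// ?cut_lip// ler_norml /K.
  have := sqr_ge0 (x j - z (j + 1)); have := sqr_ge0 (x j + z (j + 1)).
  have := sqr_ge0 (x (j + 1) - z j); have := sqr_ge0 (x (j + 1) + z j); nra.
apply: le_trans (ler_sum _ (fun j _ => h j)) _.
rewrite -mulr_sumr mulrC ler_wpM2r ?invr_ge0// -mulr_sumr !big_split/=.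
have := xA _ (win_uniq N); have := l2le_shift 1 _ _ xA _ (win_uniq N).
have := zB _ (win_uniq N); have := l2le_shift 1 _ _ zB _ (win_uniq N); lra.
Qed.

(** By y_j y_{j+1} <= (y_j^2 + y_{j+1}^2)/2 and its analogue for j - 1, only shifted weighted sums
    remain. Shifting the weight back costs at most B/N for each, and each has weight 1/2. *)
Lemma cut_coupling N (y : int -> R) (B : R) : l2le y B ->
  `|\sum_(j <- win N) cut N j * (y j * (y (j + 1) + y (j - 1)))|
  <= 2 * \sum_(j <- win N) cut N j * y j ^+ 2 + B / N%:R.
Proof.
move=> yB; apply: le_trans (ler_norm_sum _ _ _) _.
have h j : `|cut N j * (y j * (y (j + 1) + y (j - 1)))| <=
    cut N j * y j ^+ 2 + 2^-1 * (cut N j * y (j + 1) ^+ 2)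
      + 2^-1 * (cut N j * y (j - 1) ^+ 2).
  rewrite normrM ger0_norm ?cut_ge0//.
  have -> : cut N j * y j ^+ 2 + 2^-1 * (cut N j * y (j + 1) ^+ 2)
      + 2^-1 * (cut N j * y (j - 1) ^+ 2) =
    cut N j * (y j ^+ 2 + 2^-1 * y (j + 1) ^+ 2 + 2^-1 * y (j - 1) ^+ 2) by ring.
  rewrite ler_wpM2l ?cut_ge0// ler_norml.
  have := sqr_ge0 (y j - y (j + 1)); have := sqr_ge0 (y j + y (j + 1)).
  have := sqr_ge0 (y j - y (j - 1)); have := sqr_ge0 (y j + y (j - 1)); nra.
apply: le_trans (ler_sum _ (fun j _ => h j)) _.
rewrite !big_split/= -!mulr_sumr.
have lip (v : int -> R) s : `|\sum_(j <- s) (cut N j - cut N (j + 1)) * v j ^+ 2|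
    <= (\sum_(j <- s) v j ^+ 2) / N%:R.
  rewrite mulr_suml; apply: le_trans (ler_norm_sum _ _ _) _.
  apply: ler_sum => j _; rewrite normrM [X in _ * X]ger0_norm ?sqr_ge0// mulrC.
  by rewrite ler_wpM2l ?sqr_ge0 ?cut_lip.
have up : \sum_(j <- win N) cut N j * y (j + 1) ^+ 2 =
    \sum_(j <- win N) (cut N j - cut N (j + 1)) * y (j + 1) ^+ 2 +
    \sum_(j <- win N) cut N j * y j ^+ 2.
  rewrite -[RHS]addr0 -[X in _ = _ + X](win_cut_tele N (fun j => y j ^+ 2)).
  by rewrite -!big_split/=; apply: eq_bigr => j _; ring.
have dn : \sum_(j <- win N) cut N j * y (j - 1) ^+ 2 =
    - \sum_(j <- win N) (cut N j - cut N (j + 1)) * y j ^+ 2 +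
    \sum_(j <- win N) cut N j * y j ^+ 2.
  rewrite -[LHS]addr0 -[X in _ + X = _](win_cut_tele N (fun j => y (j - 1) ^+ 2)).
  rewrite -sumrN -!big_split/=.
  by apply: eq_bigr => j _; rewrite !addrK; ring.
have := lip y (win N); have := lip (fun j => y (j + 1)) (win N).
have N0 : 0 <= N%:R^-1 :> R by rewrite invr_ge0.
have := ler_wpM2r N0 (yB _ (win_uniq N)).
have := ler_wpM2r N0 (l2le_shift 1 _ _ yB _ (win_uniq N)).
rewrite up dn !ler_norml; lra.
Qed.

End cutoff.

(** * Consequences of differentiability in the sequence space *)

Section l2_derive.
Context {R : realType}.
Implicit Types (I : set R) (x : R -> int -> R) (y : int -> R).

Lemma norm_le_sqr (u e : R) : 0 <= e -> (`|u| <= e) = (u ^+ 2 <= e ^+ 2).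
Proof. by move=> e0; rewrite -[u ^+ 2]real_normK ?num_real// ler_sqr ?nnegrE. Qed.

Lemma l2_derive_eps {I x t y} : is_l2_derive I x t y ->
  forall e : R, 0 < e -> exists2 d : R, 0 < d & forall s, I s -> s != t ->
    `|s - t| < d -> l2le (fun j => (x s j - x t j) / (s - t) - y j) (e ^+ 2).
Proof.
move=> xy e e0.
have : nbhs 0%E [set z : \bar R | (z < e%:E)%E].
  apply: open_nbhs_nbhs; split; first exact: open_ereal_lt_ereal.
  by rewrite /= lte_fin.
move=> /xy; rewrite /within/= => /nbhs_ballP[d d0 h].
exists d => // s Is st sd; apply/l2norm_le; first exact: ltW.
apply/ltW/(h s) => //.
by rewrite /ball/= distrC.
Qed.

Lemma is_l2_deriveS {I J x t y} : J `<=` I ->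
  is_l2_derive I x t y -> is_l2_derive J x t y.
Proof.
move=> JI xy A /xy; rewrite /within/= => h.
by apply: (@filterS _ (dnbhs t) _ _ _ _ h) => s /= q /JI; exact: q.
Qed.

(** Each coordinate is controlled by the norm. A ball around t inside [I] turns the limit within [I]
    into an ordinary two-sided one. *)
Lemma is_l2_derive_comp {I x t y} j (d : R) : 0 < d ->
  (forall s, `|s - t| < d -> I s) -> is_l2_derive I x t y ->
  is_derive t 1 (fun s => x s j) (y j).
Proof.
move=> d0 dI xy.
have lim : (fun h => h^-1 *: (x (h *: 1 + t) j - x t j)) @ 0^' --> y j.
  apply/cvgrPdist_le => e e0; have [d' d'0 h] := l2_derive_eps xy _ e0.
  apply/nbhs_ballP; exists (Num.min d d'); first by rewrite /= lt_min d0 d'0.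
  move=> k; rewrite /ball/= sub0r normrN lt_min => /andP[kd kd'] k0.
  have E : k *: 1 + t - t = k by rewrite addrK -[LHS]/(k * 1) mulr1.
  have st : k *: 1 + t != t by rewrite -subr_eq0 E.
  have := h _ (dI _ _) st; rewrite E => /(_ kd kd')/(l2le_sqr _ _ j).
  by rewrite -(norm_le_sqr _ _ (ltW e0)) distrC mulrC; apply.
by apply: DeriveDef; [apply/cvg_ex; exists (y j)|exact/cvg_lim].
Qed.

(** Near t the difference quotient of coordinate j is at most K = 1 + |y_j|, hence |x_j(s) - x_j(t)|
    <= K |s - t|; this includes endpoints of [I]. *)
Lemma l2_derive_cw {I x} j :
  (forall t, I t -> exists y, is_l2_derive I x t y) ->
  {within I, continuous (fun s => x s j)}.
Proof.
move=> h; apply/subspace_continuousP => t It; have [y xy] := h t It.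
apply/cvgrPdist_lt => e e0; have [d d0 hd] := l2_derive_eps xy _ ltr01.
pose K := 1 + `|y j|; have K0 : 0 < K by rewrite ltr_pwDl.
apply/nbhs_ballP; exists (Num.min d (e / K)).
  by rewrite /= lt_min d0 divr_gt0.
move=> s; rewrite /ball/= lt_min => /andP[sd se] Is.
have [->|st] := eqVneq s t; first by rewrite subrr normr0.
have := hd s Is st; rewrite distrC => /(_ sd)/(l2le_sqr _ _ j).
rewrite -norm_le_sqr// => q.
have : `|(x s j - x t j) / (s - t)| <= K.
  rewrite -[X in `|X|](subrK (y j)); apply: le_trans (ler_normD _ _) _.
  by rewrite /K lerD2r.
rewrite normrM normfV ler_pdivrMr ?normr_gt0 ?subr_eq0// distrC => /le_lt_trans; apply.
by rewrite mulrC -ltr_pdivlMr// distrC.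
Qed.

(** The derivative is one difference quotient minus a remainder of norm at most 1; such a quotient
    exists because t is not isolated in [I]. *)
Lemma l2_derive_fin {I x t y} :
  (forall d : R, 0 < d -> exists s, [/\ I s, s != t & `|s - t| < d]) ->
  (forall s, I s -> exists B, l2le (x s) B) -> I t ->
  is_l2_derive I x t y -> exists B, l2le y B.
Proof.
move=> acc fin It xy; have [d d0 hd] := l2_derive_eps xy _ ltr01.
have [s [Is st sd]] := acc d d0; have [Bs hs] := fin s Is; have [Bt ht] := fin t It.
have := l2leD _ _ _ _ (l2leZ (s - t)^-1 _ _ (l2leD _ _ _ _ hs (l2leN _ _ ht)))
  (l2leN _ _ (hd s Is st sd)) => h.
eexists; apply: l2le_le h => j; rewrite le_eqVlt; apply/orP; left.
by apply/eqP; congr `|_|; ring.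
Qed.

(** Differentiability bounds the norm near each point, and compactness of [I] makes the bound
    uniform. *)
Lemma l2_locally_bounded {I x} : compact I ->
  (forall t, I t -> forall d : R, 0 < d ->
     exists s, [/\ I s, s != t & `|s - t| < d]) ->
  (forall t, I t -> exists B, l2le (x t) B) ->
  (forall t, I t -> exists y, is_l2_derive I x t y) ->
  exists B, forall t, I t -> l2le (x t) B.
Proof.
move=> /compact_near_coveringP cI acc fin der.
have : \forall B \near +oo%R, I `<=` (fun t => I t -> l2le (x t) B).
  apply: cI => t It; have [y xy] := der t It.
  have [d d0 hd] := l2_derive_eps xy _ ltr01.
  have [Bt ht] := fin t It; have [By hy] := l2_derive_fin (acc t It) fin It xy.
  (* From x(s) = x(t) + (s - t)(remainder + y) with remainder of norm at most 1 and |s - t| < d, by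
     two uses of [l2leD]. *)
  pose M := 2 * (Bt + d ^+ 2 * (2 * (1 ^+ 2 + By))).
  exists (ball t d, [set B | M <= B]).
    split; first exact: nbhsx_ballx.
    by exists M; split; [exact: num_real|move=> b /ltW].
  move=> [s B] /= [sd MB] Is; apply: (l2le_leB _ M) => //.
  have [->|st] := eqVneq s t.
    apply: (l2le_leB _ Bt) => //; rewrite /M; have := l2le_ge0 _ _ ht.
    have := l2le_ge0 _ _ hy; have := sqr_ge0 d => *.
    have : 0 <= d ^+ 2 * (2 * (1 ^+ 2 + By)) by rewrite mulr_ge0//; lra.
    lra.
  have := hd s Is st; rewrite distrC => /(_ sd) hr.
  have := l2leD _ _ _ _ ht (l2leZ (s - t) _ _ (l2leD _ _ _ _ hr hy)).
  move=> h; apply: (l2le_leB _ (2 * (Bt + (s - t) ^+ 2 * (2 * (1 ^+ 2 + By))))).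
    rewrite /M ler_wpM2l// lerD2l ler_wpM2r//.
      by have := l2le_ge0 _ _ hy; lra.
    by rewrite -(norm_le_sqr _ _ (ltW d0)) ltW// distrC.
  apply: l2le_le h => j; rewrite le_eqVlt; apply/orP; left; apply/eqP.
  by congr `|_|; field; rewrite subr_eq0.
(* A neighbourhood of infinity contains only the reals strictly above [B], hence [B + 1]. *)
move=> [B [_ hB]]; exists (B + 1) => t It.
by apply: (hB (B + 1)) => //; rewrite ltrDl.
Qed.

End l2_derive.

(** * Localized conservation law and energy estimate *)

Lemma cut_sum_le {R : realType} N (u : int -> R) (B : R) : l2le u B ->
  \sum_(j <- win N) cut N j * u j ^+ 2 <= B.
Proof.
move=> /(_ _ (win_uniq N)); apply: le_trans; apply: ler_sum => j _.
by rewrite ler_piMl ?sqr_ge0 ?cut_le1.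
Qed.

(** The cubic terms rotate (p, q) and cancel from the derivative of p^2 + q^2; the coupling leaves a
    pure flux, which is O(1/N) under the cutoff. [A] bounds p and q separately, hence the factor
    2. *)
Lemma nls_norm_le {R : realType} (nu A : R) (p q : R -> int -> R) :
  (forall (t : R) j, is_derive t 1 (fun s => p s j) (2^-1 * (q t (j + 1) + q t (j - 1))
     - 3 / 2 * nu * (p t j ^+ 2 + q t j ^+ 2) * q t j)) ->
  (forall (t : R) j, is_derive t 1 (fun s => q s j) (- 2^-1 * (p t (j + 1) + p t (j - 1))
     + 3 / 2 * nu * (p t j ^+ 2 + q t j ^+ 2) * p t j)) ->
  (forall T : R, 0 < T -> exists B, forall t : R, t \in `[- T, T] ->
     l2le (p t) B /\ l2le (q t) B) ->
  l2le (p 0) A -> l2le (q 0) A ->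
  forall t : R, l2le (p t) (2 * A) /\ l2le (q t) (2 * A).
Proof.
move=> dp dq bnd pA qA t; pose T := `|t| + 1.
have T0 : 0 < T by rewrite ltr_wpDl.
have [B hB] := bnd T T0.
pose f N s := \sum_(j <- win N) cut N j * (p s j ^+ 2 + q s j ^+ 2).
pose df N s := \sum_(j <- win N) cut N j *
      (p s j * (q s (j + 1) + q s (j - 1)) - q s j * (p s (j + 1) + p s (j - 1))).
have hdf N (s : R) : is_derive s 1 (f N) (df N s).
  apply: (dsum (win N)) => j.
  apply: is_derive_eq
    (dM (dC (cut N j) s) (dD (dX 2 (dp s j)) (dX 2 (dq s j)))) _.
  by field.
have key N : (0 < N)%N -> f N t <= 2 * A + 2 * B * `|t| / N%:R.
  move=> N0; have B0 : 0 <= B.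
    by apply: (@l2le_ge0 _ (p 0)); apply: (hB 0 _).1; rewrite in_itv/=; lra.
  have h := @gronwall R T 0 (2 * B / N%:R) (f N) (df N) (lexx _).
  have tT : t \in `[- T, T] by rewrite in_itv/= -ler_norml /T; lra.
  have -> : 2 * A + 2 * B * `|t| / N%:R =
      (2 * A + 2 * B / N%:R * `|t|) * expR (0 * `|t|).
    by rewrite mul0r expR0; ring.
  apply: (@le_trans _ _ ((f N 0 + 2 * B / N%:R * `|t|) * expR (0 * `|t|))).
    apply h => //.
    - by rewrite mulr_ge0 ?invr_ge0// mulr_ge0.
    - by apply: (@cw_derive _ _ _ (df N)) => s; exact: hdf.
    - move=> s sT; rewrite mul0r add0r mulr_natl mulr2n.
      have [ps qs] : l2le (p s) B /\ l2le (q s) B.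
        by apply: hB; move: sT; rewrite !in_itv/=; lra.
      exact: cut_flux.
  rewrite ler_wpM2r ?expR_ge0// lerD2r /f; under eq_bigr do rewrite mulrDr.
  by rewrite big_split/=; have := cut_sum_le N _ _ pA; have := cut_sum_le N _ _ qA; lra.
by split; apply: l2le_cut => N N0; apply: le_trans (key N N0);
  apply: ler_sum => j _; rewrite ler_wpM2l ?cut_ge0// ?lerDl ?lerDr sqr_ge0.
Qed.

(** Serves twice: for the Klein-Gordon solution itself, with the quartic energy kept and [g] zero,
    and for the error, with [rho = 0] and the nonlinear difference and residual placed in [g]. The
    bound [B] enters only terms of order 1/N, so it is absent from [M] and need only be finite. *)
Lemma energy_estimate {R : realType} (T eps rho kappa S0 D : R)
    (y v g res : R -> int -> R) :
  0 <= T -> 0 <= eps <= 4^-1 -> 0 <= rho -> 0 < kappa ->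
  (forall j, {within `[- T, T], continuous (fun s => y s j)}) ->
  (forall j, {within `[- T, T], continuous (fun s => v s j)}) ->
  (forall t : R, t \in `]- T, T[ -> forall j,
     is_derive t 1 (fun s => y s j) (v t j)) ->
  (forall t : R, t \in `]- T, T[ -> forall j, is_derive t 1 (fun s => v s j)
     (- y t j + eps * (y t (j + 1) + y t (j - 1)) - rho * y t j ^+ 3 - g t j)) ->
  (exists B, forall t : R, t \in `[- T, T] -> l2le (y t) B /\ l2le (v t) B) ->
  (forall t : R, t \in `]- T, T[ -> forall j,
     `|g t j| <= kappa * `|y t j| + `|res t j|) ->
  (forall t : R, t \in `]- T, T[ -> l2le (res t) D) ->
  l2le (y 0) S0 -> l2le (v 0) S0 -> 0 <= D ->
  let M := 4 * (2 * S0 + rho / 4 * S0 ^+ 2 + D * T / (2 * kappa))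
             * expR (4 * kappa * T) in
  forall t : R, t \in `[- T, T] -> l2le (y t) M /\ l2le (v t) M.
Proof.
move=> T0 eps_bnd rho0 k0 cy cv dy dv [B hB] hg hres y0 v0 D0 M t tT.
have B0 : 0 <= B.
  by apply: (@l2le_ge0 _ (y 0)); apply: (hB 0 _).1; rewrite in_itv/=; lra.
have S00 := l2le_ge0 _ _ y0.
(* The added [B / N%:R] absorbs the boundary error of the coupling term, so that the energy controls
   the weighted squares of y and v. *)
pose E N s := \sum_(j <- win N) cut N j * (2^-1 * v s j ^+ 2 + 2^-1 * y s j ^+ 2
   + rho / 4 * y s j ^+ 4 - eps / 2 * (y s j * (y s (j + 1) + y s (j - 1))))
   + B / N%:R.
pose dE N s := eps / 2 * (\sum_(j <- win N) cut N j *
      (v s j * (y s (j + 1) + y s (j - 1)) - y s j * (v s (j + 1) + v s (j - 1))))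
   - \sum_(j <- win N) cut N j * (v s j * g s j).
pose Y N s := \sum_(j <- win N) cut N j * y s j ^+ 2.
pose V N s := \sum_(j <- win N) cut N j * v s j ^+ 2.
pose Q N s := \sum_(j <- win N) cut N j * y s j ^+ 4.
pose C N s := \sum_(j <- win N) cut N j * (y s j * (y s (j + 1) + y s (j - 1))).
have EE N s : E N s = 2^-1 * V N s + 2^-1 * Y N s + rho / 4 * Q N s
    - eps / 2 * C N s + B / N%:R.
  rewrite /E /V /Y /Q /C; congr (_ + _).
  rewrite !mulr_sumr -sumrN -!big_split/=; apply: eq_bigr => j _; ring.
have hdE N (s : R) : s \in `]- T, T[ -> is_derive s 1 (E N) (dE N s).
  move=> sT.
  have h j : is_derive s 1 (fun s => cut N j *
      (2^-1 * v s j ^+ 2 + 2^-1 * y s j ^+ 2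
   + rho / 4 * y s j ^+ 4 - eps / 2 * (y s j * (y s (j + 1) + y s (j - 1)))))
   (eps / 2 * (cut N j *
      (v s j * (y s (j + 1) + y s (j - 1)) - y s j * (v s (j + 1) + v s (j - 1))))
   - cut N j * (v s j * g s j)).
    have dyj := dy s sT j; have dvj := dv s sT j.
    have dyp := dy s sT (j + 1); have dym := dy s sT (j - 1).
    apply: is_derive_eq (dM (dC (cut N j) s) (dB (dD (dD
      (dM (dC 2^-1 s) (dX 2 dvj)) (dM (dC 2^-1 s) (dX 2 dyj)))
      (dM (dC (rho / 4) s) (dX 4 dyj)))
      (dM (dC (eps / 2) s) (dM dyj (dD dyp dym))))) _.
    by rewrite /=; field.
  apply: is_derive_eq (dD (dsum (win N) h) (dC (B / N%:R) s)) _.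
  by rewrite addr0 big_split/= sumrN -mulr_sumr.
have cE N : {within `[- T, T], continuous (E N)}.
  apply: cwD; last exact: cwC.
  apply: cwsum => j; apply: cwM; first exact: cwC.
  apply: cwD; first apply: cwD; first apply: cwD.
  - by apply: cwM; [exact: cwC|exact/cwX/cv].
  - by apply: cwM; [exact: cwC|exact/cwX/cy].
  - by apply: cwM; [exact: cwC|exact/cwX/cy].
  - apply/cwN/cwM; first exact: cwC.
    by apply: cwM; [exact: cy|apply: cwD; exact: cy].
have Y0 N s : 0 <= Y N s by apply: sumr_ge0 => j _; rewrite mulr_ge0 ?cut_ge0 ?sqr_ge0.
have V0 N s : 0 <= V N s by apply: sumr_ge0 => j _; rewrite mulr_ge0 ?cut_ge0 ?sqr_ge0.
have Q0 N s : 0 <= Q N s.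
  by apply: sumr_ge0 => j _; rewrite mulr_ge0 ?cut_ge0// exprn_even_ge0.
(* Here [eps <= 4^-1] enters: the coupling costs at most [4^-1 * Y], leaving as much of the
   potential energy. *)
have CY N (s : R) : s \in `[- T, T] -> `|eps / 2 * C N s| <= 4^-1 * Y N s + 8^-1 * (B / N%:R).
  move=> /hB[yB _]; have := cut_coupling N _ _ yB; rewrite -/(C N s) -/(Y N s).
  rewrite normrM (@ger0_norm _ (eps / 2)) => [h|]; last lra.
  apply: (@le_trans _ _ (8^-1 * `|C N s|)); last lra.
  by rewrite ler_wpM2r//; lra.
have low N (s : R) : s \in `[- T, T] -> Y N s + V N s <= 4 * E N s.
  move=> sT; have := CY N s sT; rewrite EE ler_norml.
  have := Y0 N s; have := V0 N s.
  have : 0 <= rho / 4 * Q N s by rewrite mulr_ge0//; lra.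
  have : 0 <= B / N%:R by rewrite divr_ge0.
  lra.
have init N : E N 0 <= 2 * S0 + rho / 4 * S0 ^+ 2 + 2 * (B / N%:R).
  have T00 : 0 \in `[- T, T] by rewrite in_itv/=; lra.
  have := CY N 0 T00; rewrite EE ler_norml.
  have : Y N 0 <= S0 by exact: cut_sum_le.
  have : V N 0 <= S0 by exact: cut_sum_le.
  have : rho / 4 * Q N 0 <= rho / 4 * S0 ^+ 2.
    rewrite ler_wpM2l//; first lra.
    (* Each y_j^2 is at most [S0], so the fourth powers sum to at most [S0] times the squares. *)
    apply: (@le_trans _ _ (S0 * Y N 0)).
      rewrite /Q /Y mulr_sumr; apply: ler_sum => j _.
      rewrite [leRHS]mulrCA ler_wpM2l ?cut_ge0// (exprD _ 2 2) ler_wpM2r ?sqr_ge0//.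
      exact: l2le_sqr.
    by rewrite expr2 ler_wpM2l//; exact: cut_sum_le.
  have := Y0 N 0; have := V0 N 0; have : 0 <= B / N%:R by rewrite divr_ge0.
  lra.
have dEle N (s : R) : s \in `]- T, T[ ->
    `|dE N s| <= 4 * kappa * E N s + (D / (2 * kappa) + B / N%:R).
  move=> sT; have sT' : s \in `[- T, T] by move: sT; rewrite !in_itv/=; lra.
  have [yB vB] := hB s sT'; have := cut_flux N _ _ _ _ vB yB.
  set F := (X in `|X|) => hF.
  have hF' : `|eps / 2 * F| <= B / N%:R.
    rewrite normrM (@ger0_norm _ (eps / 2)); last lra.
    apply: (@le_trans _ _ (8^-1 * `|F|)); first by rewrite ler_wpM2r//; lra.
    have : 0 <= B / N%:R by rewrite divr_ge0.
    by move: hF; rewrite mulrDl; lra.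
  have hG : `|\sum_(j <- win N) cut N j * (v s j * g s j)| <=
      kappa * (Y N s + V N s) + D / (2 * kappa).
    apply: le_trans (ler_norm_sum _ _ _) _.
    apply: (@le_trans _ _ (\sum_(j <- win N) (kappa * (cut N j * y s j ^+ 2)
      + kappa * (cut N j * v s j ^+ 2) + (2 * kappa)^-1 * (cut N j * res s j ^+ 2)))).
      apply: ler_sum => j _; rewrite normrM ger0_norm ?cut_ge0//.
      have -> : kappa * (cut N j * y s j ^+ 2) + kappa * (cut N j * v s j ^+ 2)
         + (2 * kappa)^-1 * (cut N j * res s j ^+ 2) = cut N j *
         (kappa * y s j ^+ 2 + kappa * v s j ^+ 2 + (2 * kappa)^-1 * res s j ^+ 2).
        by ring.
      rewrite ler_wpM2l ?cut_ge0// normrM.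
      apply: le_trans (ler_wpM2l (normr_ge0 _) (hg s sT j)) _.
      (* AM-GM: |v| |res| <= kappa v^2 / 2 + res^2 / (2 kappa) *)
      rewrite -(real_normK (num_real (y s j))) -(real_normK (num_real (v s j))).
      rewrite -(real_normK (num_real (res s j))).
      set a := `|v s j|; set b := `|y s j|; set c := `|res s j|.
      have -> : (2 * kappa)^-1 * c ^+ 2 =
        a * c - kappa / 2 * a ^+ 2 + (2 * kappa)^-1 * (c - kappa * a) ^+ 2.
        by field; rewrite gt_eqF.
      have : 0 <= (2 * kappa)^-1 * (c - kappa * a) ^+ 2.
        by rewrite mulr_ge0 ?sqr_ge0// invr_ge0; lra.
      have : 0 <= kappa / 2 * (a - b) ^+ 2.
        by rewrite mulr_ge0 ?sqr_ge0//; lra.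
      have : 0 <= kappa / 2 * b ^+ 2 by rewrite mulr_ge0 ?sqr_ge0//; lra.
      lra.
    rewrite !big_split/= -!mulr_sumr -/(Y N s) -/(V N s).
    have : (2 * kappa)^-1 * (\sum_(j <- win N) cut N j * res s j ^+ 2) <=
      (2 * kappa)^-1 * D.
      by apply: ler_wpM2l; [rewrite invr_ge0; lra|apply: cut_sum_le; exact: hres].
    by rewrite [D / _]mulrC; lra.
  apply: le_trans (ler_normB _ _) _; rewrite -/F.
  have := ler_wpM2l (ltW k0) (low N s sT').
  by move: hF' hG; lra.
(* All dependence on [B] is gathered into one multiple of 1/N, the form that [l2le_cut] removes. *)
have key N : (0 < N)%N -> Y N t + V N t <= M +
    (4 * (2 * B + B * T) * expR (4 * kappa * T)) / N%:R.
  move=> N0; apply: le_trans (low N t tT) _.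
  have BN : 0 <= B / N%:R by rewrite divr_ge0.
  have DK : 0 <= D / (2 * kappa) by rewrite divr_ge0//; lra.
  have tT' : `|t| <= T by move: tT; rewrite in_itv/= -ler_norml.
  have h := @gronwall R T (4 * kappa) (D / (2 * kappa) + B / N%:R) (E N) (dE N).
  have h1 : E N t <= (E N 0 + (D / (2 * kappa) + B / N%:R) * `|t|)
      * expR (4 * kappa * `|t|).
    apply h => //; [lra|lra|by move=> s; exact: hdE|by move=> s; exact: dEle].
  have E0 : 0 <= E N 0.
    have : 0 \in `[- T, T] by rewrite in_itv/=; lra.
    by move=> /(low N); have := Y0 N 0; have := V0 N 0; lra.
  have h2 : (E N 0 + (D / (2 * kappa) + B / N%:R) * `|t|) * expR (4 * kappa * `|t|)
    <= (2 * S0 + rho / 4 * S0 ^+ 2 + 2 * (B / N%:R)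
        + (D / (2 * kappa) + B / N%:R) * T) * expR (4 * kappa * T).
    apply: ler_pM; rewrite ?expR_ge0//.
    - by rewrite addr_ge0// mulr_ge0//; lra.
    - by rewrite lerD ?init// ler_wpM2l//; lra.
    - by rewrite ler_expR ler_wpM2l//; lra.
  have -> : M + (4 * (2 * B + B * T) * expR (4 * kappa * T)) / N%:R =
    4 * ((2 * S0 + rho / 4 * S0 ^+ 2 + 2 * (B / N%:R)
        + (D / (2 * kappa) + B / N%:R) * T) * expR (4 * kappa * T)).
    by rewrite /M; ring.
  by rewrite ler_wpM2l//; exact: le_trans h1 h2.
split; apply: l2le_cut => N N0; apply: le_trans (key N N0).
- by rewrite -/(Y N t); have := V0 N t; lra.
- by rewrite -/(V N t); have := Y0 N t; lra.
Qed.

(** * Algebra of the approximation and its residual *)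

Section leading_algebra.
Context {R : realType}.
Implicit Types p q c s : R.

(** Real and imaginary parts of (p + iq)^3, followed by their first two slow derivatives. Every
    monomial has the shape [k * (x * y * z)], even when k is 1, so that one bound on triple products
    handles them all. *)
Definition cubP p q : R := 1 * (p * p * p) - 3 * (p * q * q).
Definition cubQ p q : R := 3 * (p * p * q) - 1 * (q * q * q).
Definition dcubP p q p1 q1 : R :=
  3 * (p1 * p * p) - 3 * (p1 * q * q) - 6 * (p * q * q1).
Definition dcubQ p q p1 q1 : R :=
  6 * (p1 * p * q) + 3 * (q1 * p * p) - 3 * (q1 * q * q).
Definition ddcubP p q p1 q1 p2 q2 : R :=
  6 * (p1 * p1 * p) + 3 * (p2 * p * p) - 3 * (p2 * q * q) - 12 * (p1 * q * q1)
  - 6 * (q1 * q1 * p) - 6 * (q2 * p * q).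
Definition ddcubQ p q p1 q1 p2 q2 : R :=
  6 * (p1 * p1 * q) + 6 * (p2 * p * q) + 12 * (p1 * p * q1) + 3 * (q2 * p * p)
  - 6 * (q1 * q1 * q) - 3 * (q2 * q * q).

(** This is 2 Re(a e^{it}) + (rho/4) Re(a^3 e^{3it}) at one site; [lead1] and [lead2] are its time
    derivatives, a factor [eps] accompanying each slow derivative. Trigonometric values are free
    variables, which makes the residual identity polynomial. *)
Definition lead (rho p q c s c3 s3 : R) : R :=
  2 * (p * c - q * s) + rho / 4 * (cubP p q * c3 - cubQ p q * s3).

Definition lead1 (rho eps p q p1 q1 c s c3 s3 : R) : R :=
  2 * (eps * p1 * c - p * s - (eps * q1 * s + q * c))
  + rho / 4 * (eps * dcubP p q p1 q1 * c3 - 3 * (cubP p q * s3)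
     - (eps * dcubQ p q p1 q1 * s3 + 3 * (cubQ p q * c3))).

Definition lead2 (rho eps p q p1 q1 p2 q2 c s c3 s3 : R) : R :=
  2 * (eps ^+ 2 * p2 * c - 2 * eps * p1 * s - p * c
       - (eps ^+ 2 * q2 * s + 2 * eps * q1 * c - q * s))
  + rho / 4 * (eps ^+ 2 * ddcubP p q p1 q1 p2 q2 * c3
      - 6 * eps * dcubP p q p1 q1 * s3 - 9 * (cubP p q * c3)
     - (eps ^+ 2 * ddcubQ p q p1 q1 p2 q2 * s3
        + 6 * eps * dcubQ p q p1 q1 * c3 - 9 * (cubQ p q * s3))).

(* p + iq is the amplitude at a site, (p1, q1) and (p2, q2) its first two slow
   derivatives, pp, qp, pm, qm the neighbouring amplitudes, and c3, s3 are the
   cosine and sine of the tripled angle. *)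
Lemma residual_eq (rho eps nu p q p1 q1 p2 q2 pp pm qp qm c s c3 s3 : R) :
  eps * nu = rho -> c ^+ 2 + s ^+ 2 = 1 ->
  c3 = c ^+ 3 - 3 * c * s ^+ 2 -> s3 = 3 * c ^+ 2 * s - s ^+ 3 ->
  p1 = 2^-1 * (qp + qm) - 3 / 2 * nu * (p ^+ 2 + q ^+ 2) * q ->
  q1 = - 2^-1 * (pp + pm) + 3 / 2 * nu * (p ^+ 2 + q ^+ 2) * p ->
  let X := lead rho p q c s c3 s3 in
  let u := 2 * (p * c - q * s) in
  lead2 rho eps p q p1 q1 p2 q2 c s c3 s3 + X + rho * X ^+ 3
    - eps * (lead rho pp qp c s c3 s3 + lead rho pm qm c s c3 s3) =
  2 * eps ^+ 2 * (p2 * c - q2 * s)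
  + rho / 4 * eps ^+ 2 * (ddcubP p q p1 q1 p2 q2 * c3 - ddcubQ p q p1 q1 p2 q2 * s3)
  - 3 / 2 * rho * eps * (dcubQ p q p1 q1 * c3 + dcubP p q p1 q1 * s3)
  - eps * rho / 4 * ((cubP pp qp * c3 - cubQ pp qp * s3)
                     + (cubP pm qm * c3 - cubQ pm qm * s3))
  + rho ^+ 2 / 4 * (cubP p q * c3 - cubQ p q * s3) * (X ^+ 2 + X * u + u ^+ 2).
Proof.
move=> enu cs E3 F3 Ep Eq X u.
have W : X = u + rho / 4 * (cubP p q * c3 - cubQ p q * s3) by [].
(* With z = a e^{it} and u = z + conj z, u^3 = 2 Re z^3 + 6 |a|^2 Re z: a third harmonic and a
   resonant part. *)
have U3 : u ^+ 3 = 2 * (cubP p q * c3 - cubQ p q * s3)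
    + 6 * (p ^+ 2 + q ^+ 2) * (p * c - q * s).
  have -> : p ^+ 2 + q ^+ 2 = (p ^+ 2 + q ^+ 2) * (c ^+ 2 + s ^+ 2).
    by rewrite cs mulr1.
  rewrite /u E3 F3 /cubP /cubQ; ring.
have X3 : X ^+ 3 = u ^+ 3 + rho / 4 * (cubP p q * c3 - cubQ p q * s3)
    * (X ^+ 2 + X * u + u ^+ 2) by rewrite W; ring.
rewrite X3 U3 W.
set w := cubP p q * c3 - cubQ p q * s3.
(* The slow equation converts the order-eps terms into the coupling and the resonant cubic part,
   which they then cancel. *)
have lin : eps * p1 * s + eps * q1 * c = 2^-1 * eps * ((qp + qm) * s - (pp + pm) * c)
    + 3 / 2 * rho * (p ^+ 2 + q ^+ 2) * (p * c - q * s).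
  by rewrite Ep Eq -enu; ring.
have -> : lead2 rho eps p q p1 q1 p2 q2 c s c3 s3 =
  2 * eps ^+ 2 * (p2 * c - q2 * s) - 4 * (eps * p1 * s + eps * q1 * c)
  - 2 * (p * c - q * s)
  + rho / 4 * (eps ^+ 2 * (ddcubP p q p1 q1 p2 q2 * c3 - ddcubQ p q p1 q1 p2 q2 * s3)
      - 6 * eps * (dcubP p q p1 q1 * s3 + dcubQ p q p1 q1 * c3) - 9 * w).
  by rewrite /lead2 /w; ring.
rewrite lin /u /lead.
set a := cubP pp qp; set b := cubQ pp qp; set a' := cubP pm qm; set b' := cubQ pm qm.
set dP := dcubP _ _ _ _; set dQ := dcubQ _ _ _ _.
set eP := ddcubP _ _ _ _ _ _; set eQ := ddcubQ _ _ _ _ _ _.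
(* The third harmonic drops out since (1 - 9) rho/4 + 2 rho = 0. *)
by field.
Qed.

Lemma normD_le (x y a b : R) : `|x| <= a -> `|y| <= b -> `|x + y| <= a + b.
Proof. by move=> xa yb; apply: le_trans (ler_normD _ _) _; exact: lerD. Qed.

Lemma normB_le (x y a b : R) : `|x| <= a -> `|y| <= b -> `|x - y| <= a + b.
Proof. by move=> xa yb; apply: le_trans (ler_normB _ _) _; exact: lerD. Qed.

Lemma normM_le (x y a b : R) : `|x| <= a -> `|y| <= b -> `|x * y| <= a * b.
Proof. by move=> xa yb; rewrite normrM ler_pM. Qed.

Lemma norm1_le (x y a : R) : `|x| <= a -> `|y| <= 1 -> `|x * y| <= a.
Proof. by move=> xa yb; rewrite -[a]mulr1; exact: normM_le. Qed.

Context {G L : R}.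
Hypothesis GL : G <= L.

(** [G] will depend on the site and be square summable, [L] will be uniform. Keeping one factor [G]
    makes cubic expressions inherit its summability. *)
Lemma norm_triple (k : nat) (x y z : R) : `|x| <= G -> `|y| <= G -> `|z| <= G ->
  `|k%:R * (x * y * z)| <= k%:R * (L ^+ 2 * G).
Proof.
move=> xG yG zG; apply: normM_le; first by rewrite normr_nat.
rewrite [L ^+ 2 * G](_ : _ = G * L * L); last by ring.
by apply: normM_le; [apply: normM_le|]; rewrite ?(le_trans _ GL).
Qed.

Lemma norm_triple1 (x y z : R) : `|x| <= G -> `|y| <= G -> `|z| <= G ->
  `|1 * (x * y * z)| <= 1 * (L ^+ 2 * G).
Proof. by have := @norm_triple 1 x y z; rewrite mulr1n. Qed.

Ltac bound_cubic :=
  repeat first [apply: normB_le | apply: normD_le];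
  first [exact: norm_triple | exact: norm_triple1].

Context {p q p1 q1 p2 q2 : R}.
Hypotheses (pG : `|p| <= G) (qG : `|q| <= G) (p1G : `|p1| <= G)
  (q1G : `|q1| <= G) (p2G : `|p2| <= G) (q2G : `|q2| <= G).

(** The constants 4, 12 and 36 here and below are the sums of the absolute values of the
    coefficients. *)
Lemma cub_le : `|cubP p q| <= 4 * (L ^+ 2 * G) /\ `|cubQ p q| <= 4 * (L ^+ 2 * G).
Proof.
split; [rewrite [leRHS](_ : _ = 1 * (L ^+ 2 * G) + 3 * (L ^+ 2 * G))|
  rewrite [leRHS](_ : _ = 3 * (L ^+ 2 * G) + 1 * (L ^+ 2 * G))];
  try ring; bound_cubic.
Qed.

Lemma dcub_le : `|dcubP p q p1 q1| <= 12 * (L ^+ 2 * G) /\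
  `|dcubQ p q p1 q1| <= 12 * (L ^+ 2 * G).
Proof.
set Z := L ^+ 2 * G; split; [rewrite [leRHS](_ : _ = 3 * Z + 3 * Z + 6 * Z)|
  rewrite [leRHS](_ : _ = 6 * Z + 3 * Z + 3 * Z)]; try ring; bound_cubic.
Qed.

Lemma ddcub_le : `|ddcubP p q p1 q1 p2 q2| <= 36 * (L ^+ 2 * G) /\
  `|ddcubQ p q p1 q1 p2 q2| <= 36 * (L ^+ 2 * G).
Proof.
set Z := L ^+ 2 * G.
split; [rewrite [leRHS](_ : _ = 6 * Z + 3 * Z + 3 * Z + 12 * Z + 6 * Z + 6 * Z)|
  rewrite [leRHS](_ : _ = 6 * Z + 6 * Z + 12 * Z + 3 * Z + 6 * Z + 3 * Z)];
  try ring; bound_cubic.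
Qed.

End leading_algebra.

(** * Pointwise bounds on the approximation and the residual *)

Section leading_bounds.
Context {R : realType} {G L rho eps c s c3 s3 p q p1 q1 p2 q2 : R}.
Hypotheses (G0 : 0 <= G) (GL : G <= L) (L1 : 1 <= L).
Hypotheses (rho0 : 0 <= rho) (rho_eps : rho <= eps) (eps1 : eps <= 1).
Hypotheses (c_1 : `|c| <= 1) (s_1 : `|s| <= 1) (c3_1 : `|c3| <= 1) (s3_1 : `|s3| <= 1).
Hypotheses (pG : `|p| <= G) (qG : `|q| <= G) (p1G : `|p1| <= G)
  (q1G : `|q1| <= G) (p2G : `|p2| <= G) (q2G : `|q2| <= G).

Let Z := L ^+ 2 * G.

Let GZ : G <= Z.
Proof. by rewrite /Z ler_peMl// exprn_ege1. Qed.

Let eps_1 (x a : R) : `|x| <= a -> `|eps * x| <= a.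
Proof.
by move=> xa; rewrite mulrC; apply: norm1_le => //; rewrite ger0_norm ?(le_trans rho0).
Qed.

Lemma lead_le : `|lead rho p q c s c3 s3| <= 6 * Z.
Proof.
move: (rho0) (rho_eps) (eps1) (G0) (GL) (L1) => r0 re e1 g0 gl l1.
have [P4 Q4] := cub_le GL pG qG.
apply: (@le_trans _ _ (2 * (G + G) + 4^-1 * (4 * Z + 4 * Z))); last first.
  by have := GZ; lra.
apply: normD_le; apply: normM_le.
- by rewrite normr_nat.
- by apply: normB_le; exact: norm1_le.
- rewrite ger0_norm; lra.
- by apply: normB_le; exact: norm1_le.
Qed.

Lemma lead1_le : `|lead1 rho eps p q p1 q1 c s c3 s3| <= 20 * Z.
Proof.
move: (rho0) (rho_eps) (eps1) (G0) (GL) (L1) => r0 re e1 g0 gl l1.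
have [P4 Q4] := cub_le GL pG qG.
have [P12 Q12] := dcub_le GL pG qG p1G q1G.
apply: (@le_trans _ _ (2 * (G + G + (G + G))
  + 4^-1 * (12 * Z + 3 * (4 * Z) + (12 * Z + 3 * (4 * Z))))); last first.
  by have := GZ; lra.
have three (x a : R) : `|x| <= a -> `|3 * x| <= 3 * a.
  by apply: normM_le; rewrite normr_nat.
apply: normD_le; apply: normM_le.
- by rewrite normr_nat.
- apply: normB_le; [apply: normB_le|apply: normD_le]; apply: norm1_le => //; exact: eps_1.
- rewrite ger0_norm; lra.
- by apply: normB_le; [apply: normB_le|apply: normD_le];
    [apply: norm1_le => //; exact: eps_1|apply: three; exact: norm1_le
    |apply: norm1_le => //; exact: eps_1|apply: three; exact: norm1_le].
Qed.

(** Every term has at least two factors among [eps] and [rho], and [rho <= eps <= 1]. L^8 is L^2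
    from a cubic expression times L^6 from (6 L^3)^2; the coefficients add up to 4 + 58 + 216 =
    278. *)
Lemma residual_le {pp qp pm qm : R} (X u : R) :
  `|pp| <= G -> `|qp| <= G -> `|pm| <= G -> `|qm| <= G ->
  X = lead rho p q c s c3 s3 -> u = 2 * (p * c - q * s) ->
  `|2 * eps ^+ 2 * (p2 * c - q2 * s)
  + rho / 4 * eps ^+ 2 * (ddcubP p q p1 q1 p2 q2 * c3 - ddcubQ p q p1 q1 p2 q2 * s3)
  - 3 / 2 * rho * eps * (dcubQ p q p1 q1 * c3 + dcubP p q p1 q1 * s3)
  - eps * rho / 4 * ((cubP pp qp * c3 - cubQ pp qp * s3)
                     + (cubP pm qm * c3 - cubQ pm qm * s3))
  + rho ^+ 2 / 4 * (cubP p q * c3 - cubQ p q * s3) * (X ^+ 2 + X * u + u ^+ 2)|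
  <= 300 * L ^+ 8 * G * eps ^+ 2.
Proof.
move: (rho0) (rho_eps) (eps1) (G0) (GL) (L1) => r0 re e1 g0 gl l1.
move=> ppG qpG pmG qmG XE uE.
have [P4 Q4] := cub_le GL pG qG.
have [Pp Qp] := cub_le GL ppG qpG.
have [Pm Qm] := cub_le GL pmG qmG.
have [P12 Q12] := dcub_le GL pG qG p1G q1G.
have [P36 Q36] := ddcub_le GL pG qG p1G q1G p2G q2G.
have eps0 : 0 <= eps by lra.
have ee : 0 <= eps ^+ 2 by exact: sqr_ge0.
have L6 : L <= L ^+ 3 by rewrite exprS ler_peMr ?exprn_ege1//; lra.
have Z3 : Z <= L ^+ 3 by rewrite /Z [L ^+ 3]exprSr ler_wpM2l// sqr_ge0.
have X6 : `|X| <= 6 * L ^+ 3.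
  by rewrite XE; apply: le_trans lead_le _; rewrite ler_wpM2l.
have u6 : `|u| <= 6 * L ^+ 3.
  apply: (@le_trans _ _ (2 * (G + G))); last by lra.
  rewrite uE; apply: normM_le; first by rewrite normr_nat.
  by apply: normB_le; exact: norm1_le.
set B := L ^+ 6; have BE : 6 * L ^+ 3 * (6 * L ^+ 3) = 36 * B.
  by rewrite /B (exprM L 3 2); ring.
have B1 : 1 <= B by exact: exprn_ege1.
have ZE : Z * B = L ^+ 8 * G by rewrite /Z /B (exprD L 2 6); ring.
have Z0 : 0 <= Z by rewrite mulr_ge0 ?sqr_ge0.
have ZB : Z <= Z * B by rewrite ler_peMr.
have sqX : `|X ^+ 2 + X * u + u ^+ 2| <= 36 * B + 36 * B + 36 * B.
  by rewrite -BE !expr2; apply: normD_le; [apply: normD_le|]; exact: normM_le.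
have re' : rho * eps <= eps ^+ 2 by rewrite expr2 ler_wpM2r.
have rr : rho ^+ 2 <= eps ^+ 2 by rewrite ler_sqr ?nnegrE.
have re2 : rho * eps ^+ 2 <= eps ^+ 2 by rewrite ler_piMl//; lra.
have re0 : 0 <= rho * eps by rewrite mulr_ge0.
have rr0 : 0 <= rho ^+ 2 by exact: sqr_ge0.
have re20 : 0 <= rho * eps ^+ 2 by rewrite mulr_ge0.
apply: (@le_trans _ _ (2 * eps ^+ 2 * (G + G) + 4^-1 * eps ^+ 2 * (36 * Z + 36 * Z)
  + 3 / 2 * eps ^+ 2 * (12 * Z + 12 * Z)
  + 4^-1 * eps ^+ 2 * (4 * Z + 4 * Z + (4 * Z + 4 * Z))
  + 4^-1 * eps ^+ 2 * (4 * Z + 4 * Z) * (36 * B + 36 * B + 36 * B))); last first.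
  rewrite -subr_ge0 [X in 0 <= X](_ : _ = eps ^+ 2 *
    (300 * (L ^+ 8 * G) - 4 * G - 58 * Z - 216 * (Z * B))); last by field.
  by apply: mulr_ge0 => //; rewrite -ZE; have := GZ; lra.
apply: normD_le; [apply: normB_le; [apply: normB_le; [apply: normD_le|]|]|].
- apply: normM_le; first by rewrite ger0_norm; lra.
  by apply: normB_le; exact: norm1_le.
- apply: normM_le; first by rewrite ger0_norm; lra.
  by apply: normB_le; exact: norm1_le.
- apply: normM_le; first by rewrite ger0_norm; lra.
  by apply: normD_le; exact: norm1_le.
- apply: normM_le; first by rewrite ger0_norm; lra.
  by apply: normD_le; apply: normB_le; exact: norm1_le.
- apply: normM_le => //; apply: normM_le; first by rewrite ger0_norm; lra.
  by apply: normB_le; exact: norm1_le.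
Qed.

End leading_bounds.

(** * A square-summable envelope for the amplitude and its slow derivatives *)

(** Slow derivative of the real part of the amplitude; that of the imaginary part is the negative
    with [p] and [q] exchanged, so one set of bounds covers both. *)
Definition nls_rhs {R : realType} (nu : R) (p q : int -> R) (j : int) : R :=
  2^-1 * (q (j + 1) + q (j - 1)) - 3 / 2 * nu * (p j ^+ 2 + q j ^+ 2) * q j.

Definition nls_rhs1 {R : realType} (nu : R) (p q p1 q1 : int -> R) (j : int) : R :=
  2^-1 * (q1 (j + 1) + q1 (j - 1))
  - 3 / 2 * nu * (2 * (p j * p1 j + q j * q1 j) * q j
                  + (p j ^+ 2 + q j ^+ 2) * q1 j).

(* Dominates the amplitude and its first two slow derivatives at site j, up to a
   constant: each derivative reaches one site further. *)
Definition env {R : realType} (p q : int -> R) (j : int) : R :=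
  (`|p (j - 2)| + `|q (j - 2)|) + (`|p (j - 1)| + `|q (j - 1)|)
  + ((`|p (j + 1)| + `|q (j + 1)|) + (`|p (j + 2)| + `|q (j + 2)|))
  + (`|p j| + `|q j|).

(** The brackets in [env] match nested uses of [l2leD]: 4 A for one site, 16 A for a pair, 64 A for
    four, then 2 (64 + 4) A. *)
Lemma env_l2 {R : realType} (p q : int -> R) (A : R) :
  l2le p A -> l2le q A -> l2le (env p q) (136 * A).
Proof.
move=> pA qA; pose k j := `|p j| + `|q j|.
have kA : l2le k (2 * (A + A)).
  by apply: l2leD; [apply: l2le_le pA|apply: l2le_le qA] => j; rewrite normr_id.
have h := l2leD _ _ _ _ (l2leD _ _ _ _
  (l2leD _ _ _ _ (l2le_shift (- 2) _ _ kA) (l2le_shift (- 1) _ _ kA))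
  (l2leD _ _ _ _ (l2le_shift 1 _ _ kA) (l2le_shift 2 _ _ kA))) kA.
by apply: l2le_leB h; lra.
Qed.

Lemma env_ge0 {R : realType} (p q : int -> R) j : 0 <= env p q j.
Proof. by rewrite /env !addr_ge0. Qed.

Lemma env_le {R : realType} (p q : int -> R) j i :
  i \in [:: j - 2; j - 1; j; j + 1; j + 2] ->
  `|p i| <= env p q j /\ `|q i| <= env p q j.
Proof.
have n0 (x : R) := normr_ge0 x.
rewrite /env !inE.
have := n0 (p (j - 2)); have := n0 (p (j - 1)); have := n0 (p j).
have := n0 (p (j + 1)); have := n0 (p (j + 2)).
have := n0 (q (j - 2)); have := n0 (q (j - 1)); have := n0 (q j).
have := n0 (q (j + 1)); have := n0 (q (j + 2)) => ? ? ? ? ? ? ? ? ? ?.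
by move=> /orP[|/orP[|/orP[|/orP[]]]] /eqP ->; lra.
Qed.

Lemma env_leA {R : realType} (p q : int -> R) (A : R) j :
  (forall i, `|p i| <= A) -> (forall i, `|q i| <= A) -> env p q j <= 10 * A.
Proof.
move=> pA qA; rewrite /env.
have := pA (j - 2); have := pA (j - 1); have := pA (j + 1); have := pA (j + 2).
have := qA (j - 2); have := qA (j - 1); have := qA (j + 1); have := qA (j + 2).
have := pA j; have := qA j; lra.
Qed.

Lemma nls_rhs_le {R : realType} (nu A E : R) (p q : int -> R) j :
  0 <= nu -> nu <= 1 -> 1 <= A -> 0 <= E ->
  `|p j| <= A -> `|q j| <= A -> `|q j| <= E ->
  `|q (j + 1)| <= E -> `|q (j - 1)| <= E ->
  `|nls_rhs nu p q j| <= 4 * A ^+ 2 * E.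
Proof.
move=> nu0 nu1 A1 E0 pA qA qE qpE qmE.
have EA : E <= A ^+ 2 * E by rewrite ler_peMl// exprn_ege1.
apply: (@le_trans _ _ (2^-1 * (E + E) + 3 / 2 * 1 * (A ^+ 2 + A ^+ 2) * E)); last lra.
apply: normB_le; apply: normM_le => //.
- by rewrite ger0_norm.
- exact: normD_le.
- apply: normM_le; first by apply: normM_le; rewrite ger0_norm.
  by rewrite !expr2; apply: normD_le; exact: normM_le.
Qed.

Lemma nls_rhs1_le {R : realType} (nu A F : R) (p q p1 q1 : int -> R) j :
  0 <= nu -> nu <= 1 -> 1 <= A -> 0 <= F ->
  `|p j| <= A -> `|q j| <= A -> `|p1 j| <= F -> `|q1 j| <= F ->
  `|q1 (j + 1)| <= F -> `|q1 (j - 1)| <= F ->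
  `|nls_rhs1 nu p q p1 q1 j| <= 10 * A ^+ 2 * F.
Proof.
move=> nu0 nu1 A1 F0 pA qA pF qF qpF qmF.
have FA : F <= A ^+ 2 * F by rewrite ler_peMl// exprn_ege1.
apply: (@le_trans _ _ (2^-1 * (F + F) + 3 / 2 * 1 * (2 * (A * F + A * F) * A
   + (A ^+ 2 + A ^+ 2) * F))).
  apply: normB_le; apply: normM_le => //.
  - by rewrite ger0_norm.
  - exact: normD_le.
  - by apply: normM_le; rewrite ger0_norm.
  - apply: normD_le; apply: normM_le => //.
    + apply: normM_le; first by rewrite normr_nat.
      by apply: normD_le; exact: normM_le.
    + by rewrite !expr2; apply: normD_le; exact: normM_le.
suff : 2 * (A * F + A * F) * A = 4 * (A ^+ 2 * F) by lra.
by ring.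
Qed.

Lemma mem_neighbours (i j : int) : i \in [:: j - 1; j; j + 1] ->
  [/\ i \in [:: j - 2; j - 1; j; j + 1; j + 2],
     i + 1 \in [:: j - 2; j - 1; j; j + 1; j + 2] &
     i - 1 \in [:: j - 2; j - 1; j; j + 1; j + 2]].
Proof.
have e1 : j - 1 + 1 = j by rewrite subrK.
have e2 : j - 1 - 1 = j - 2 by lia.
have e3 : j + 1 - 1 = j by rewrite addrK.
have e4 : j + 1 + 1 = j + 2 by lia.
by rewrite !inE => /orP[|/orP[]] /eqP ->; rewrite ?e1 ?e2 ?e3 ?e4 !eqxx ?orbT.
Qed.

(** Two slow derivatives cost the factors 4 A^2 and 10 A^2, whence 40 A^4; the uniform bound follows
    from [env <= 10 * A]. *)
Lemma envelope {R : realType} (nu A : R) (p q : int -> R) :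
  0 <= nu -> nu <= 1 -> 1 <= A ->
  (forall j, `|p j| <= A) -> (forall j, `|q j| <= A) ->
  let p1 := nls_rhs nu p q in
  let q1 := fun j => - nls_rhs nu q p j in
  let p2 := nls_rhs1 nu p q p1 q1 in
  let q2 := fun j => - nls_rhs1 nu q p q1 p1 j in
  forall j, let G := 40 * A ^+ 4 * env p q j in
  [/\ 0 <= G, G <= 400 * A ^+ 5,
     [/\ `|p j| <= G, `|q j| <= G, `|p1 j| <= G & `|q1 j| <= G],
     `|p2 j| <= G /\ `|q2 j| <= G &
     [/\ `|p (j + 1)| <= G, `|q (j + 1)| <= G, `|p (j - 1)| <= G
       & `|q (j - 1)| <= G]].
Proof.
move=> nu0 nu1 A1 pA qA p1 q1 p2 q2 j G.
set E := env p q j; have E0 : 0 <= E by exact: env_ge0.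
have AA : 1 <= A ^+ 2 by exact: exprn_ege1.
have EF : E <= 4 * A ^+ 2 * E by rewrite ler_peMl//; lra.
have GE : G = 10 * A ^+ 2 * (4 * A ^+ 2 * E) by rewrite /G /E; ring.
have FG : 4 * A ^+ 2 * E <= G.
  by rewrite GE ler_peMl//; [rewrite mulr_ge0//; lra|lra].
have EG := le_trans EF FG.
have mem i : i \in [:: j - 2; j - 1; j; j + 1; j + 2] ->
    `|p i| <= E /\ `|q i| <= E by exact: env_le.
have v1 i : i \in [:: j - 1; j; j + 1] ->
    `|p1 i| <= 4 * A ^+ 2 * E /\ `|q1 i| <= 4 * A ^+ 2 * E.
  move=> hi.
  have [/mem[pi qi] /mem[pp qp] /mem[pm qm]] := mem_neighbours _ _ hi.
  by split; rewrite ?normrN; exact: nls_rhs_le.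
have [pj qj] := mem j ltac:(by rewrite !inE eqxx ?orbT).
have [pp qp] := mem (j + 1) ltac:(by rewrite !inE eqxx ?orbT).
have [pm qm] := mem (j - 1) ltac:(by rewrite !inE eqxx ?orbT).
have [p1j q1j] := v1 j ltac:(by rewrite !inE eqxx ?orbT).
have [p1p q1p] := v1 (j + 1) ltac:(by rewrite !inE eqxx ?orbT).
have [p1m q1m] := v1 (j - 1) ltac:(by rewrite !inE eqxx ?orbT).
have F0 : 0 <= 4 * A ^+ 2 * E by exact: le_trans EF.
split.
- exact: le_trans EG.
- rewrite /G (_ : 400 * A ^+ 5 = 40 * A ^+ 4 * (10 * A)); last by ring.
  by rewrite ler_wpM2l ?env_leA// mulr_ge0// exprn_ge0//; lra.
- by split; [exact: le_trans EG|exact: le_trans EG|exact: le_trans FG|exact: le_trans FG].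
- by split; rewrite ?normrN GE; exact: nls_rhs1_le.
- by split; exact: le_trans EG.
Qed.

(** * Real components and their derivatives *)

Lemma leading_orderE {R : realType} (rho eps : R) (a : R -> int -> R[i]) t j :
  leading_order rho eps a t j =
  lead rho (complex.Re (a (eps * t) j)) (complex.Im (a (eps * t) j))
    (cos t) (sin t) (cos (3 * t)) (sin (3 * t)).
Proof.
rewrite /leading_order /lead /cubP /cubQ; case: (a (eps * t) j) => p q.
have -> : (8^-1 : R[i]) = (8^-1)%:C%C by rewrite fmorphV rmorph_nat.
rewrite /expi !cosN !sinN !exprS !expr0 !mulr1.
change ((p +i* q)%C^*) with (p -i* q)%C.
by rewrite /=; field.
Qed.

Lemma nls_components {R : realType} (nu : R) (a b ap am : R[i]) :
  2 * 'i * b + 3 * nu%:C%C * `|a| ^+ 2 * a = ap + am ->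
  let p := complex.Re a in let q := complex.Im a in
  complex.Re b = 2^-1 * (complex.Im ap + complex.Im am)
    - 3 / 2 * nu * (p ^+ 2 + q ^+ 2) * q /\
  complex.Im b = - (2^-1 * (complex.Re ap + complex.Re am)
    - 3 / 2 * nu * (q ^+ 2 + p ^+ 2) * p).
Proof.
case: a b ap am => [p q] [x y] [pp qp] [pm qm] /=.
have -> : `|(p +i* q)%C| ^+ 2 = (p ^+ 2 + q ^+ 2)%:C%C.
  rewrite -[`|_|]/((Num.sqrt (p ^+ 2 + q ^+ 2))%:C%C) -rmorphXn/=.
  by rewrite sqr_sqrtr ?addr_ge0 ?sqr_ge0.
have -> : (2 : R[i]) = 2%:C%C by rewrite rmorph_nat.
have -> : (3 : R[i]) = 3%:C%C by rewrite rmorph_nat.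
rewrite -complexiE => -[/= h1 h2]; split; lra.
Qed.

Lemma itv_no_isolated {R : realType} (T : R) : 0 < T -> forall t : R,
  t \in `[- T, T] -> forall d : R, 0 < d ->
  exists s, [/\ s \in `[- T, T], s != t & `|s - t| < d].
Proof.
move=> T0 t; rewrite in_itv/= => tT d d0; pose e := Num.min (d / 2) T.
have e0 : 0 < e by rewrite lt_min T0 divr_gt0.
have ed : e <= d / 2 by rewrite ge_min lexx.
have eT : e <= T by rewrite ge_min lexx orbT.
(* Moving in the direction of zero by at most [T] stays inside the interval, even from an
   endpoint. *)
have [t0|t0] := leP t 0; [exists (t + e)|exists (t - e)];
  (split; [by rewrite in_itv/=; lra|by apply/eqP; lra|]).
- by rewrite addrC addrA addNr add0r gtr0_norm//; lra.
- by rewrite addrC addrA addNr add0r normrN gtr0_norm//; lra.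
Qed.

Lemma l2_derive_bounded {R : realType} (T : R) (x : R -> int -> R) : 0 < T ->
  (forall t, t \in `[- T, T] -> exists B, l2le (x t) B) ->
  (forall t, t \in `[- T, T] -> exists y, is_l2_derive `[- T, T] x t y) ->
  exists B, forall t, t \in `[- T, T] -> l2le (x t) B.
Proof.
move=> T0 fin der; apply: l2_locally_bounded => //; first exact: segment_compact.
exact: itv_no_isolated.
Qed.

Lemma dNLS_components {R : realType} (nu : R) (a : R -> int -> R[i]) :
  dNLS_solution nu a ->
  let p t j := complex.Re (a t j) in let q t j := complex.Im (a t j) in
  [/\ forall (t : R) j, is_derive t 1 (fun s => p s j) (nls_rhs nu (p t) (q t) j),
      forall (t : R) j, is_derive t 1 (fun s => q s j) (- nls_rhs nu (q t) (p t) j) &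
      forall T : R, 0 < T -> exists B, forall t, t \in `[- T, T] ->
        l2le (p t) B /\ l2le (q t) B].
Proof.
move=> sol p q.
have eqs t b j : 2 * 'i * b j + 3 * nu%:C%C * `|a t j| ^+ 2 * a t j
        = a t (j + 1) + a t (j - 1) -> complex.Re (b j) = nls_rhs nu (p t) (q t) j /\
    complex.Im (b j) = - nls_rhs nu (q t) (p t) j by exact: nls_components.
split.
- move=> t j; have [_ [b [[db _] /(_ j)/eqs[<- _]]]] := sol t.
  exact: (is_l2_derive_comp j 1 ltr01 _ db).
- move=> t j; have [_ [b [[_ db] /(_ j)/eqs[_ <-]]]] := sol t.
  exact: (is_l2_derive_comp j 1 ltr01 _ db).
- move=> T T0.
  have [Bp hp] : exists B, forall t, t \in `[- T, T] -> l2le (p t) B.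
    apply: l2_derive_bounded => // t _.
      by have [/l2normC_fin[B pB _] _] := sol t; exists B.
    have [_ [b [[db _] _]]] := sol t; eexists; apply: is_l2_deriveS db.
    exact: subsetT.
  have [Bq hq] : exists B, forall t, t \in `[- T, T] -> l2le (q t) B.
    apply: l2_derive_bounded => // t _.
      by have [/l2normC_fin[B _ qB] _] := sol t; exists B.
    have [_ [b [[_ db] _]]] := sol t; eexists; apply: is_l2_deriveS db.
    exact: subsetT.
  exists (Num.max Bp Bq) => t tT; split.
    by apply: l2le_leB (hp t tT); rewrite le_max lexx.
  by apply: l2le_leB (hq t tT); rewrite le_max lexx orbT.
Qed.

Lemma dNLS_l2_le {R : realType} (nu A : R) (a : R -> int -> R[i]) :
  dNLS_solution nu a ->
  l2le (fun j => complex.Re (a 0 j)) A -> l2le (fun j => complex.Im (a 0 j)) A ->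
  forall t, l2le (fun j => complex.Re (a t j)) (2 * A) /\
            l2le (fun j => complex.Im (a t j)) (2 * A).
Proof.
move=> /dNLS_components[dp dq bnd] p0 q0.
have h := @nls_norm_le R nu A _ _ dp _ bnd p0 q0; apply h => t j.
by apply: is_derive_eq (dq t j) _; rewrite /nls_rhs; ring.
Qed.

Lemma nls_rhs_derive {R : realType} (nu : R) (p q p1 q1 : R -> int -> R) :
  (forall (t : R) j, is_derive t 1 (fun s => p s j) (p1 t j)) ->
  (forall (t : R) j, is_derive t 1 (fun s => q s j) (q1 t j)) ->
  forall (t : R) j, is_derive t 1 (fun s => nls_rhs nu (p s) (q s) j)
    (nls_rhs1 nu (p t) (q t) (p1 t) (q1 t) j).
Proof.
move=> dp dq t j; rewrite /nls_rhs.
apply: is_derive_eq (dB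
  (dM (dC 2^-1 t) (dD (dq t (j + 1)) (dq t (j - 1))))
  (dM (dM (dC (3 / 2 * nu) t) (dD (dX 2 (dp t j)) (dX 2 (dq t j)))) (dq t j))) _.
by rewrite /nls_rhs1 /=; field.
Qed.

Lemma lead_derive {R : realType} (rho eps t : R) (p q : R -> R) (p1 q1 : R) :
  is_derive (eps * t) 1 p p1 -> is_derive (eps * t) 1 q q1 ->
  is_derive t 1 (fun s => lead rho (p (eps * s)) (q (eps * s))
     (cos s) (sin s) (cos (3 * s)) (sin (3 * s)))
   (lead1 rho eps (p (eps * t)) (q (eps * t)) p1 q1
     (cos t) (sin t) (cos (3 * t)) (sin (3 * t))).
Proof.
move=> /dlin dp /dlin dq; rewrite /lead /cubP /cubQ.
apply: is_derive_eq (dD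
  (dM (dC 2 t) (dB (dM dp (is_derive_cos t)) (dM dq (is_derive_sin t))))
  (dM (dC (rho / 4) t) (dB
    (dM (dB (dM (dC 1 t) (dM (dM dp dp) dp)) (dM (dC 3 t) (dM (dM dp dq) dq)))
        (dcoslin 3 t))
    (dM (dB (dM (dC 3 t) (dM (dM dp dp) dq)) (dM (dC 1 t) (dM (dM dq dq) dq)))
        (dsinlin 3 t))))) _.
by rewrite /lead1 /dcubP /dcubQ /cubP /cubQ; field.
Qed.

Lemma lead1_derive {R : realType} (rho eps t : R) (p q p1 q1 : R -> R) (p2 q2 : R) :
  is_derive (eps * t) 1 p (p1 (eps * t)) -> is_derive (eps * t) 1 q (q1 (eps * t)) ->
  is_derive (eps * t) 1 p1 p2 -> is_derive (eps * t) 1 q1 q2 ->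
  is_derive t 1 (fun s => lead1 rho eps (p (eps * s)) (q (eps * s))
     (p1 (eps * s)) (q1 (eps * s)) (cos s) (sin s) (cos (3 * s)) (sin (3 * s)))
   (lead2 rho eps (p (eps * t)) (q (eps * t)) (p1 (eps * t)) (q1 (eps * t)) p2 q2
     (cos t) (sin t) (cos (3 * t)) (sin (3 * t))).
Proof.
move=> /dlin dp /dlin dq /dlin dp1 /dlin dq1.
rewrite /lead1 /dcubP /dcubQ /cubP /cubQ.
have e := dC eps t; have n1 := dC 1 t; have n3 := dC 3 t; have n6 := dC 6 t.
have dc := is_derive_cos t; have ds := is_derive_sin t.
have dc3 := dcoslin 3 t; have ds3 := dsinlin 3 t.
have cP := dB (dM n1 (dM (dM dp dp) dp)) (dM n3 (dM (dM dp dq) dq)).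
have cQ := dB (dM n3 (dM (dM dp dp) dq)) (dM n1 (dM (dM dq dq) dq)).
have cP1 := dB (dB (dM n3 (dM (dM dp1 dp) dp)) (dM n3 (dM (dM dp1 dq) dq)))
   (dM n6 (dM (dM dp dq) dq1)).
have cQ1 := dB (dD (dM n6 (dM (dM dp1 dp) dq)) (dM n3 (dM (dM dq1 dp) dp)))
   (dM n3 (dM (dM dq1 dq) dq)).
apply: is_derive_eq (dD
  (dM (dC 2 t) (dB (dB (dM (dM e dp1) dc) (dM dp ds)) (dD (dM (dM e dq1) ds) (dM dq dc))))
  (dM (dC (rho / 4) t) (dB (dB (dM (dM e cP1) dc3) (dM n3 (dM cP ds3)))
     (dD (dM (dM e cQ1) ds3) (dM n3 (dM cQ dc3)))))) _.
by rewrite /lead2 /ddcubP /ddcubQ /dcubP /dcubQ /cubP /cubQ; field.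
Qed.

Lemma cos3_sin3 {R : realType} (t : R) :
  cos (3 * t) = cos t ^+ 3 - 3 * cos t * sin t ^+ 2 /\
  sin (3 * t) = 3 * cos t ^+ 2 * sin t - sin t ^+ 3.
Proof.
have -> : 3 * t = t + t + t by ring.
by split; rewrite !(cosD, sinD); ring.
Qed.

(** * The approximation solves the lattice equation up to a small residual *)

Section leading_order_dynamics.
Context {R : realType}.
Variables (rho eps A0 : R) (a : R -> int -> R[i]).

(** [A] bounds every amplitude because the squares are at most 2 A0 <= A^2; [L] is the uniform bound
    on the envelope and [envB] bounds its squared norm. All depend on [A0] alone, which makes the
    final constants independent of [eps]. *)
Let A := 1 + 2 * A0.
Let L := 400 * A ^+ 5.
Let envB := (40 * A ^+ 4) ^+ 2 * (136 * (2 * A0)).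
Let X := leading_order rho eps a.
Let Xd := leading_order_dot rho eps a.

Definition lead_l2 := 400 * L ^+ 4 * envB.
Definition residual_l2 := (300 * L ^+ 8) ^+ 2 * envB.

Lemma leading_order_dynamics :
  0 < rho -> rho <= eps -> eps <= 1 -> dNLS_solution (rho / eps) a ->
  l2le (fun j => complex.Re (a 0 j)) A0 -> l2le (fun j => complex.Im (a 0 j)) A0 ->
  [/\ forall (t : R) j, is_derive t 1 (fun s => X s j) (Xd t j),
      exists2 r : R -> int -> R,
        forall (t : R) j, is_derive t 1 (fun s => Xd s j)
          (- X t j + eps * (X t (j + 1) + X t (j - 1)) - rho * X t j ^+ 3 + r t j) &
        forall t, l2le (r t) (residual_l2 * eps ^+ 4),
      forall t, l2le (X t) lead_l2 & forall t, l2le (Xd t) lead_l2].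
Proof.
move=> rho0 rho_eps eps1 sol p0 q0.
have eps0 : 0 < eps by lra.
have A00 := l2le_ge0 _ _ p0.
have A1 : 1 <= A by rewrite /A; lra.
have L1 : 1 <= L.
  by rewrite /L; have := exprn_ege1 5 A1; lra.
pose nu := rho / eps.
have nu0 : 0 <= nu by rewrite divr_ge0// ltW.
have nu1 : nu <= 1 by rewrite ler_pdivrMr// mul1r.
have enu : eps * nu = rho by rewrite /nu mulrC divfK// gt_eqF.
have [dp dq _] := dNLS_components _ _ sol.
have l2 := dNLS_l2_le _ _ _ sol p0 q0.
move: dp dq l2; rewrite -/nu.
set p := fun t j => complex.Re (a t j); set q := fun t j => complex.Im (a t j).
move=> dp dq l2.
pose p1 t := nls_rhs nu (p t) (q t).
pose q1 t := fun j => - nls_rhs nu (q t) (p t) j.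
pose p2 t := nls_rhs1 nu (p t) (q t) (p1 t) (q1 t).
pose q2 t := fun j => - nls_rhs1 nu (q t) (p t) (q1 t) (p1 t) j.
have dp1 (t : R) j : is_derive t 1 (fun s => p1 s j) (p2 t j).
  have h := nls_rhs_derive nu p q p1 q1 dp dq; apply h.
have dq1 (t : R) j : is_derive t 1 (fun s => q1 s j) (q2 t j).
  have h := nls_rhs_derive nu q p q1 p1 dq dp; exact: dN (h t j).
have pA t j : `|p t j| <= A.
  rewrite norm_le_sqr; last lra.
  by have := l2le_sqr _ _ j (l2 t).1; rewrite /A -/(p t j); nra.
have qA t j : `|q t j| <= A.
  rewrite norm_le_sqr; last lra.
  by have := l2le_sqr _ _ j (l2 t).2; rewrite /A -/(q t j); nra.
pose G t j := 40 * A ^+ 4 * env (p t) (q t) j.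
have GB t : l2le (G t) envB by apply: l2leZ; apply: env_l2; apply l2.
have XE t j : X t j = lead rho (p (eps * t) j) (q (eps * t) j)
    (cos t) (sin t) (cos (3 * t)) (sin (3 * t)) by exact: leading_orderE.
have dX0 (t : R) j : is_derive t 1 (fun s => X s j)
   (lead1 rho eps (p (eps * t) j) (q (eps * t) j) (p1 (eps * t) j) (q1 (eps * t) j)
     (cos t) (sin t) (cos (3 * t)) (sin (3 * t))).
  under eq_fun do rewrite XE.
  exact: lead_derive (dp _ j) (dq _ j).
have XdE t j : Xd t j =
   lead1 rho eps (p (eps * t) j) (q (eps * t) j) (p1 (eps * t) j) (q1 (eps * t) j)
     (cos t) (sin t) (cos (3 * t)) (sin (3 * t)).
  by rewrite /Xd /leading_order_dot derive1E; have [_ ->] := dX0 t j.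
have unit (x y : R) : x ^+ 2 + y ^+ 2 = 1 -> `|x| <= 1 /\ `|y| <= 1.
  by move=> xy; rewrite !norm_le_sqr ?expr1n//; have := sqr_ge0 x; have := sqr_ge0 y; lra.
have trig (s : R) : `|cos s| <= 1 /\ `|sin s| <= 1 by exact/unit/cos2Dsin2.
(* Domination by a multiple of the envelope at every site becomes a norm bound uniform in time,
   since [GB] holds at every slow time. *)
have env_scale (k : R) (f : R -> int -> R) : 0 <= k ->
    (forall t j, `|f t j| <= k * G (eps * t) j) -> forall t, l2le (f t) (k ^+ 2 * envB).
  move=> k0 fG t; apply: l2le_le (l2leZ k _ _ (GB (eps * t))) => j.
  by apply: le_trans (fG t j) _; exact: ler_norm.
have L0 : 0 <= L by lra.
have leadE : lead_l2 = (20 * L ^+ 2) ^+ 2 * envB by rewrite /lead_l2; ring.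
have k0 : 0 <= 20 * L ^+ 2 by exact: mulr_ge0 (ler0n _ 20) (sqr_ge0 L).
split.
- by move=> t j; rewrite XdE; exact: dX0.
(* The residual is defined as the defect of [X] in the equation, so all the content lies in its
   bound. *)
- pose r t j := lead2 rho eps (p (eps * t) j) (q (eps * t) j)
      (p1 (eps * t) j) (q1 (eps * t) j) (p2 (eps * t) j) (q2 (eps * t) j)
      (cos t) (sin t) (cos (3 * t)) (sin (3 * t))
    + X t j + rho * X t j ^+ 3 - eps * (X t (j + 1) + X t (j - 1)).
  exists r => t.
    move=> j; under eq_fun do rewrite XdE.
    apply: is_derive_eq
      (lead1_derive rho eps t _ _ _ _ _ _ (dp _ j) (dq _ j) (dp1 _ j) (dq1 _ j)) _.
    by rewrite /r; ring.
  have -> : residual_l2 * eps ^+ 4 = (300 * L ^+ 8 * eps ^+ 2) ^+ 2 * envB.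
    by rewrite /residual_l2; ring.
  have k1 : 0 <= 300 * L ^+ 8 * eps ^+ 2.
    exact: mulr_ge0 (mulr_ge0 (ler0n _ 300) (exprn_ge0 8 L0)) (sqr_ge0 eps).
  apply: (env_scale _ r k1).
  move=> {}t j.
  have [G0 GL [pG qG p1G q1G] [p2G q2G] [ppG qpG pmG qmG]] :=
    envelope nu A _ _ nu0 nu1 A1 (pA (eps * t)) (qA (eps * t)) j.
  have [c1 s1] := trig t; have [c31 s31] := trig (3 * t).
  have [c3E s3E] := cos3_sin3 t.
  rewrite /r !XE.
  have Eq : q1 (eps * t) j = - 2^-1 * (p (eps * t) (j + 1) + p (eps * t) (j - 1))
     + 3 / 2 * nu * (p (eps * t) j ^+ 2 + q (eps * t) j ^+ 2) * p (eps * t) j.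
    by rewrite /q1 /nls_rhs; ring.
  have := residual_eq rho eps nu _ _ (p1 (eps * t) j) (q1 (eps * t) j)
    (p2 (eps * t) j) (q2 (eps * t) j) (p (eps * t) (j + 1)) (p (eps * t) (j - 1))
    (q (eps * t) (j + 1)) (q (eps * t) (j - 1)) _ _ _ _ enu (cos2Dsin2 t) c3E s3E
    erefl Eq.
  cbv zeta => ->.
  rewrite (_ : 300 * L ^+ 8 * eps ^+ 2 * G (eps * t) j =
    300 * L ^+ 8 * G (eps * t) j * eps ^+ 2); last by ring.
  exact: (residual_le G0 GL L1 (ltW rho0) rho_eps eps1 c1 s1 c31 s31
    pG qG p1G q1G p2G q2G _ _ ppG qpG pmG qmG erefl erefl).
- move=> t; rewrite leadE; apply: (env_scale _ X k0) => {}t j; rewrite XE.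
  have [G0 GL [pG qG p1G q1G] [p2G q2G] [ppG qpG pmG qmG]] :=
    envelope nu A _ _ nu0 nu1 A1 (pA (eps * t)) (qA (eps * t)) j.
  have [c1 s1] := trig t; have [c31 s31] := trig (3 * t).
  apply: le_trans (lead_le G0 GL L1 (ltW rho0) rho_eps eps1 c1 s1 c31 s31 pG qG) _.
  rewrite -[leRHS]mulrA; apply: ler_wpM2r; first exact: mulr_ge0 (sqr_ge0 L) G0.
  by rewrite ler_nat.
- move=> t; rewrite leadE; apply: (env_scale _ Xd k0) => {}t j; rewrite XdE.
  have [G0 GL [pG qG p1G q1G] [p2G q2G] [ppG qpG pmG qmG]] :=
    envelope nu A _ _ nu0 nu1 A1 (pA (eps * t)) (qA (eps * t)) j.
  have [c1 s1] := trig t; have [c31 s31] := trig (3 * t).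
  rewrite -[leRHS]mulrA.
  exact: (lead1_le G0 GL L1 (ltW rho0) rho_eps eps1 c1 s1 c31 s31 pG qG p1G q1G).
Qed.

End leading_order_dynamics.

(** * The Klein-Gordon solution and the error estimate *)

Lemma dKG_components {R : realType} (rho eps T : R) (xi eta : R -> int -> R) :
  0 < T -> dKG_solution rho eps `[- T, T] xi eta ->
  [/\ forall j, {within `[- T, T], continuous (fun s => xi s j)},
      forall j, {within `[- T, T], continuous (fun s => eta s j)},
      forall t : R, t \in `]- T, T[ -> forall j,
        is_derive t 1 (fun s => xi s j) (eta t j),
      forall t : R, t \in `]- T, T[ -> forall j, is_derive t 1 (fun s => eta s j)
        (- xi t j + eps * (xi t (j + 1) + xi t (j - 1)) - rho * xi t j ^+ 3) &
      exists B, forall t : R, t \in `[- T, T] -> l2le (xi t) B /\ l2le (eta t) B].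
Proof.
move=> T0 sol.
have dxi t : t \in `[- T, T] -> exists y, is_l2_derive `[- T, T] xi t y.
  by move=> /sol[_ _ h _]; exists (eta t).
have deta t : t \in `[- T, T] -> exists y, is_l2_derive `[- T, T] eta t y.
  by move=> /sol[_ _ _ [z [h _]]]; exists z.
have inner t : t \in `]- T, T[ -> exists2 d : R, 0 < d &
    forall s, `|s - t| < d -> s \in `[- T, T].
  rewrite in_itv/= => tT; exists (Num.min (t + T) (T - t)).
    by rewrite lt_min; lra.
  by move=> s; rewrite lt_min !ltr_norml in_itv/=; lra.
have sub t : t \in `]- T, T[ -> t \in `[- T, T] by rewrite !in_itv/=; lra.
split.
- by move=> j; apply: l2_derive_cw => t; exact: dxi.
- by move=> j; apply: l2_derive_cw => t; exact: deta.
- move=> t tT j; have [d d0 dI] := inner t tT; have [_ _ h _] := sol t (sub t tT).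
  exact: (is_l2_derive_comp j d d0 dI h).
- move=> t tT j; have [d d0 dI] := inner t tT.
  have [_ _ _ [z [h /(_ j) zE]]] := sol t (sub t tT).
  apply: is_derive_eq (is_l2_derive_comp j d d0 dI h) _; lra.
- have [B1 h1] := l2_derive_bounded T xi T0
    (fun t tT => let: And4 h _ _ _ := sol t tT in l2norm_fin _ h) dxi.
  have [B2 h2] := l2_derive_bounded T eta T0
    (fun t tT => let: And4 _ h _ _ := sol t tT in l2norm_fin _ h) deta.
  exists (Num.max B1 B2) => t tT; split.
    by apply: l2le_leB (h1 t tT); rewrite le_max lexx.
  by apply: l2le_leB (h2 t tT); rewrite le_max lexx orbT.
Qed.

Lemma l2leB {R : realType} (u v : int -> R) (A B : R) :
  l2le u A -> l2le v B -> l2le (fun j => u j - v j) (2 * (A + B)).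
Proof. by move=> uA vB; exact: l2leD uA (l2leN _ _ vB). Qed.

Section justification.
Context {R : realType}.
Variables (A0 tau0 : R).

(** Squared norms: [X0] for the approximation and its derivative, [S0] for the initial data, [M1]
    for xi on the whole interval. [K] bounds |xi^2 + xi X + X^2|. *)
Let X0 : R := lead_l2 A0.
Let S0 : R := 2 * (1 + X0).
Let M1 : R := 4 * (2 * S0 + S0 ^+ 2) * expR (4 * tau0).
Let K : R := 1 + 2 * (M1 + X0).

(** In the energy estimate with kappa = rho K, D proportional to eps^4 and T = tau0/rho, the term D
    T/(2 kappa) is a multiple of (eps^2/rho)^2, as is the initial error; the exponent 4 kappa T
    equals 4 K tau0. *)
Definition error_const : R :=
  4 * (2 + residual_l2 A0 * tau0 / (2 * K)) * expR (4 * K * tau0).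

Lemma justification (rho eps : R) (a : R -> int -> R[i]) (xi eta : R -> int -> R) :
  0 < tau0 -> 0 < rho -> rho <= eps -> eps <= 4^-1 -> eps ^+ 2 / rho <= 1 ->
  dNLS_solution (rho / eps) a ->
  l2le (fun j => complex.Re (a 0 j)) A0 -> l2le (fun j => complex.Im (a 0 j)) A0 ->
  let X := leading_order rho eps a in
  let Xd := leading_order_dot rho eps a in
  let T := tau0 * rho^-1 in
  dKG_solution rho eps `[- T, T] xi eta ->
  l2le (fun j => xi 0 j - X 0 j) ((eps ^+ 2 / rho) ^+ 2) ->
  l2le (fun j => eta 0 j - Xd 0 j) ((eps ^+ 2 / rho) ^+ 2) ->
  forall t : R, t \in `[- T, T] ->
    l2le (fun j => xi t j - X t j) (error_const * (eps ^+ 2 / rho) ^+ 2) /\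
    l2le (fun j => eta t j - Xd t j) (error_const * (eps ^+ 2 / rho) ^+ 2).
Proof.
move=> tau00 rho0 rho_eps eps_4 delta1 sol p0 q0 X Xd T kg.
set delta := eps ^+ 2 / rho; move=> y0 v0.
have T0 : 0 < T by rewrite divr_gt0.
have [cxi ceta dxi deta [B hB]] := dKG_components _ _ _ _ _ T0 kg.
have eps1 : eps <= 1 by lra.
have [dX [r dXd rB] XB XdB] :=
  leading_order_dynamics rho eps A0 a rho0 rho_eps eps1 sol p0 q0.
rewrite -/X -/Xd in dX dXd XB XdB.
have X00 : 0 <= X0 := l2le_ge0 _ _ (XB 0).
have S00 : 0 <= S0 by rewrite /S0; lra.
have T00 : 0 <= T := ltW T0.
have eps_bnd : 0 <= eps <= 4^-1 by lra.
have rho1 : rho <= 1 by lra.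
have rhoT : rho * T = tau0 by rewrite /T mulrCA divff ?mulr1// gt_eqF.
have delta2 : delta ^+ 2 <= 1.
  by rewrite expr_le1// divr_ge0 ?sqr_ge0// ltW.
have start (u v : int -> R) : l2le (fun j => u j - v j) (delta ^+ 2) ->
    l2le v X0 -> l2le u S0.
  move=> uv /(l2leD _ _ _ _ uv) h; apply: (l2le_leB _ (2 * (delta ^+ 2 + X0))).
    by rewrite /S0; lra.
  by apply: l2le_le h => j; rewrite subrK.
have xi0 : l2le (xi 0) S0 := start _ _ y0 (XB 0).
have eta0 : l2le (eta 0) S0 := start _ _ v0 (XdB 0).
have xiB t : t \in `[- T, T] -> l2le (xi t) M1.
  (* The a priori bound: kappa = rho with no forcing, and rho T = tau0 keeps the exponential
     independent of [eps]. *)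
  move=> tT; have h := @energy_estimate R T eps rho rho S0 0 xi eta
    (fun _ _ => 0) (fun _ _ => 0) T00 eps_bnd (ltW rho0) rho0 cxi ceta dxi.
  apply: (l2le_leB _ (4 * (2 * S0 + rho / 4 * S0 ^+ 2 + 0 * T / (2 * rho))
             * expR (4 * rho * T))).
    rewrite !mul0r addr0 -[4 * rho * T]mulrA rhoT /M1 ler_wpM2r ?expR_ge0//.
    rewrite ler_wpM2l// lerD2l ler_piMl ?sqr_ge0//; lra.
  apply h => //.
  - by move=> s sT j; rewrite subr0; exact: deta.
  - by exists B.
  - by move=> s _ j; rewrite !normr0 addr0 mulr_ge0// ltW.
  - by move=> s _ l _; rewrite big1// => i _; rewrite expr0n.
have M10 : 0 <= M1 by apply: (l2le_ge0 (xi 0)); apply: xiB; rewrite in_itv/=; lra.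
have K1 : 1 <= K by rewrite /K; lra.
pose y t j := xi t j - X t j; pose v t j := eta t j - Xd t j.
(* xi^3 - X^3 = (xi^2 + xi X + X^2)(xi - X), so the cubic difference is linear in the error with a
   bounded coefficient. *)
pose g t j := rho * ((xi t j ^+ 2 + xi t j * X t j + X t j ^+ 2) * y t j) + r t j.
have h := @energy_estimate R T eps 0 (rho * K) (delta ^+ 2) (residual_l2 A0 * eps ^+ 4)
  y v g r T00 eps_bnd (lexx _).
have -> : error_const * delta ^+ 2 = 4 * (2 * delta ^+ 2 + 0 / 4 * delta ^+ 2 ^+ 2
    + residual_l2 A0 * eps ^+ 4 * T / (2 * (rho * K))) * expR (4 * (rho * K) * T).
  have -> : 4 * (rho * K) * T = 4 * K * tau0 by rewrite -rhoT; ring.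
  rewrite /error_const /T /delta; field.
  by rewrite !gt_eqF//; lra.
apply h.
- by rewrite mulr_gt0//; lra.
- by move=> j; apply: cwD => //; apply/cwN/(cw_derive (dX^~ j)).
- move=> j; apply: cwD => //; apply/cwN.
  exact: (cw_derive (dXd^~ j)).
- by move=> t tT j; exact: dB (dxi t tT j) (dX t j).
- move=> t tT j; apply: is_derive_eq (dB (deta t tT j) (dXd t j)) _.
  by rewrite /g /y; ring.
- exists (2 * (B + X0)) => t /hB[xB eB]; split; [exact: l2leB xB (XB t)|].
  exact: l2leB eB (XdB t).
- move=> t tT j; apply: normD_le => //.
  rewrite normrM gtr0_norm// -mulrA ler_wpM2l ?(ltW rho0)// normrM ler_wpM2r//.
  have : xi t j ^+ 2 <= M1.
    by apply: l2le_sqr; apply: xiB; move: tT; rewrite !in_itv/=; lra.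
  have : X t j ^+ 2 <= X0 by exact: l2le_sqr (XB t).
  rewrite ler_norml /K; have := sqr_ge0 (xi t j + X t j).
  by have := sqr_ge0 (xi t j - X t j); nra.
- by move=> t _; exact: rB.
- exact: y0.
- exact: v0.
- exact: (l2le_ge0 _ _ (rB 0)).
Qed.

End justification.

(** * From the asymptotic range to uniform constants *)

Lemma near_at_right0 {R : realType} (P : R -> Prop) :
  (\forall e \near 0^'+, P e) -> exists2 e0 : R, 0 < e0 &
    forall e, 0 < e < e0 -> P e.
Proof.
rewrite /at_right /within/= => /nbhs_ballP[d d0 h]; exists d => // e /andP[e0 ed].
by apply: h => //; rewrite /ball/= sub0r normrN gtr0_norm.
Qed.

Theorem theorem1 (R : realType) (rho : R -> R) (a0 : int -> R[i])
    (rho_range : \forall eps \near 0^'+, 0 < rho eps <= eps)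
    (rho_asymp : eps ^+ 2 / rho eps @[eps --> 0^'+] --> (0 : R))
    (a0_l2 : (l2normC a0 < +oo)%E)
    (tau0 : R) (tau0_gt0 : 0 < tau0) :
  exists eps0 C0 C : R,
    [/\ 0 < eps0, 0 < C0, 0 < C &
      forall eps : R, 0 < eps < eps0 ->
      forall a : R -> int -> R[i],
        dNLS_solution (rho eps / eps) a ->
        (forall j : int, a 0 j = a0 j) ->
      let X := leading_order (rho eps) eps a in
      let Xdot := leading_order_dot (rho eps) eps a in
      forall xi xidot : R -> int -> R,
        dKG_solution (rho eps) eps
          `[- (tau0 * (rho eps)^-1), tau0 * (rho eps)^-1] xi xidot ->
        (l2norm (xi 0 \- X 0)%R
           + l2norm (xidot 0 \- Xdot 0)%R
         <= (C0 * (rho eps)^-1 * eps ^+ 2)%:E)%E ->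
      forall t : R, - (tau0 * (rho eps)^-1) <= t <= tau0 * (rho eps)^-1 ->
        (l2norm (xi t \- X t)%R
           + l2norm (xidot t \- Xdot t)%R
         <= (C * (rho eps)^-1 * eps ^+ 2)%:E)%E].
Proof.
have [A0 p0 q0] := l2normC_fin _ a0_l2.
have [e1 e10 range] := near_at_right0 _ rho_range.
have [e2 e20 small] : exists2 e : R, 0 < e &
    forall eps, 0 < eps < e -> `|eps ^+ 2 / rho eps| <= 1.
  apply: near_at_right0; move/cvgrPdist_le: rho_asymp => /(_ 1 ltr01).
  by apply: filterS => e; rewrite sub0r normrN.
(* Any number at least 1 whose square dominates [error_const] would do. *)
pose C1 := 1 + `|error_const A0 tau0|.
(* 1/4 serves the energy estimate, [e1] the range of rho, and [e2] makes eps^2/rho at most 1. The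
   factor 2 counts the two norms in the conclusion. *)
exists (Num.min 4^-1 (Num.min e1 e2)), 1, (2 * C1).
have C10 : 1 <= C1 by rewrite lerDl.
split; [by rewrite !lt_min e10 e20 invr_gt0; lra|by []|by lra|].
move=> eps; rewrite !lt_min => /andP[eps0 /and3P[eps4 epse1 epse2]] a sol a00.
move=> X Xd xi eta kg init t tT.
have /andP[rho0 rho_eps] : 0 < rho eps <= eps by apply: range; rewrite eps0.
pose delta := eps ^+ 2 / rho eps.
have delta0 : 0 <= delta by rewrite divr_ge0 ?sqr_ge0// ltW.
have delta1 : delta <= 1.
  by apply: le_trans (ler_norm _) _; apply: small; rewrite eps0.
have n0 (u : int -> R) : (0 <= l2norm u)%E by exact: sqrte_ge0.
have deltaE : 1 * (rho eps)^-1 * eps ^+ 2 = delta by rewrite mul1r mulrC.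
rewrite deltaE in init.
have y0 : l2le (fun j => xi 0 j - X 0 j) (delta ^+ 2).
  by apply/l2norm_le => //; apply: le_trans init; exact: leeDl.
have v0 : l2le (fun j => eta 0 j - Xd 0 j) (delta ^+ 2).
  by apply/l2norm_le => //; apply: le_trans init; exact: leeDr.
have p0' : l2le (fun j => complex.Re (a 0 j)) A0.
  by under eq_fun do rewrite a00.
have q0' : l2le (fun j => complex.Im (a 0 j)) A0.
  by under eq_fun do rewrite a00.
have [yt vt] := justification A0 tau0 _ _ _ _ _ tau0_gt0 rho0 rho_eps (ltW eps4)
  delta1 sol p0' q0' kg y0 v0 t tT.
have -> : 2 * C1 * (rho eps)^-1 * eps ^+ 2 = C1 * delta + C1 * delta.
  by rewrite /delta; ring.
have Cd : error_const A0 tau0 * delta ^+ 2 <= (C1 * delta) ^+ 2.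
  rewrite [leRHS]exprMn ler_wpM2r ?sqr_ge0//; apply: le_trans (ler_norm _) _.
  by rewrite /C1; have := normr_ge0 (error_const A0 tau0); nra.
have Cd0 : 0 <= C1 * delta by rewrite mulr_ge0//; lra.
by rewrite EFinD; apply: leeD; apply/l2norm_le => //;
  [apply: l2le_leB yt|apply: l2le_leB vt].
Qed.
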